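(* Let $(R,\mathfrak m)$ be a Cohen-Macaulay local ring of dimension $d\ge 2$ with infinite residue field. Let $I_1$ and $I_2$ be $\mathfrak m$-primary ideals of $R$ and let $(x_1,\dots,x_d)$ be a minimal reduction of $I_2$ generated by a superficial sequence $x_1,\dots,x_d$ for $I_2$ and $I_1$. Then for all $n\ge 1$, $$\Delta^d[P(n)-H(n)]=\ell\!\left(\frac{I_1I_2^n+(x_1,\dots,x_d)}{(x_1,\dots,x_d)}\right)-\sum_{i=1}^d(-1)^i h_i(1,n)=\ell\!\left(\frac{I_1I_2^n}{(x_1,\dots,x_d)I_1I_2^{n-1}}\right)-\sum_{i=2}^d(-1)^i h_i(1,n).$$
   Context: $\ell$ denotes length. Convention: $I^n=R$ for $n\le 0$. $H(n):=\ell(R/I_1I_2^n)$ for $n\in\mathbb Z$, and $P(n)$ is the polynomial with $P(n)=H(n)$ for $n\gg0$. $\Delta$ is the backward difference operator $\Delta f(n)=f(n)-f(n-1)$. For $n\in\mathbb Z$, let $C(1,n)$ be the complex whose degree $i$ term ($0\le i\le d$) is $(R/I_1I_2^{n-i})^{\binom di}$ and whose differentials are induced by those of the Koszul complex $K_\bullet(x_1,\dots,x_d;R)$. Put $h_i(1,n):=\ell(H_i(C(1,n)))$. An element $x\in I_2$ is superficial for $I_2$ and $I_1$ if there is a positive integer $r_0$ such that $xR\cap I_1^sI_2^r=xI_1^sI_2^{r-1}$ for all $r\ge r_0$ and all $s\ge0$. A sequence $x_1,\dots,x_d$ in $I_2$ is a superficial sequence for $I_2$ and $I_1$ if for each $i$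 the image of $x_i$ in $R/(x_1,\dots,x_{i-1})$ is superficial for the images of $I_2$ and $I_1$. *)

(* Defs.v *)
From HB Require Import structures.
From mathcomp Require Import all_boot all_order all_algebra.
From mathcomp Require Import all_classical.

Set Implicit Arguments.
Unset Strict Implicit.
Unset Printing Implicit Defensive.

Import GRing.Theory.
Local Open Scope classical_set_scope.
Local Open Scope ring_scope.
Local Open Scope quotient_scope.

Definition submodule (R : pzRingType) (V : lmodType R) (N : set V) : Prop :=
  submod_closed (fun v : V => v \in N).

Definition span (R : pzRingType) (V : lmodType R) (G : set V) : set V :=
  smallest (@submodule R V) G.

Lemma submodule_span (R : pzRingType) (V : lmodType R) (G : set V) :
  submodule (span G).
Proof.
split=> [|a u v]; first by rewrite inE => N [[N0 _] _]; rewrite inE in N0.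
rewrite !inE => Gu Gv N [Nsub GN].
have := Nsub.2 a u v; rewrite !inE; apply.
  exact: Gu.
exact: Gv.
Qed.

Lemma span_id (R : pzRingType) (V : lmodType R) (N : set V) :
  submodule N -> span N = N.
Proof. by move=> Nsub; apply: smallest_id. Qed.

Definition spanb (R : pzRingType) (V : lmodType R) (G : set V) : V -> bool :=
  fun v => v \in span G.

HB.instance Definition _ (R : pzRingType) (V : lmodType R) (G : set V) :=
  GRing.isSubmodClosed.Build R V (spanb G)
    (GRing.submod_closed_semi (submodule_span G)).

Definition span_zmod (R : pzRingType) (V : lmodType R) (G : set V) :
    zmodClosed V :=
  GRing.ZmodClosed.clone V (spanb G) _.

(** [qmod N] is V / N.  It is total in [N : set V], dividing by [span N], which
    is [N] whenever [N] is a submodule ([span_id]). *)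
Definition qmod (R : pzRingType) (V : lmodType R) (N : set V) : Type :=
  Quotient.quot (span_zmod N).

Section QuotientModule.
Variables (R : pzRingType) (V : lmodType R) (N : set V).

HB.instance Definition _ := GRing.Zmodule.on (qmod N).
HB.instance Definition _ : EqQuotient V (Quotient.equiv (span_zmod N)) (qmod N) :=
  EqQuotient.on (qmod N).
HB.instance Definition _ := ZmodQuotient.on (qmod N).

Lemma eq_pi_qmod (u v : V) :
  (\pi_(qmod N) u == \pi_(qmod N) v) = (u - v \in span N).
Proof. by rewrite -[RHS]/(u - v \in spanb N) -Quotient.idealrBE. Qed.

Definition qmod_scale (a : R) (u : qmod N) : qmod N :=
  \pi_(qmod N) (a *: repr u).

Lemma pi_scale (a : R) (v : V) :
  \pi_(qmod N) (a *: v) = qmod_scale a (\pi_(qmod N) v).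
Proof.
rewrite /qmod_scale; apply/eqP; rewrite eq_pi_qmod -scalerBr.
rewrite -[_ \in _]/(_ \in spanb N) rpredZ //.
by rewrite -[_ \in _]/(_ \in span N) -eq_pi_qmod reprK.
Qed.

Lemma qmod_scaleA a b (u : qmod N) :
  qmod_scale a (qmod_scale b u) = qmod_scale (a * b) u.
Proof.
rewrite -[u]reprK -[qmod_scale b _]pi_scale -[LHS]pi_scale -[RHS]pi_scale.
by rewrite scalerA.
Qed.

Lemma qmod_scale1 : left_id 1 qmod_scale.
Proof. by move=> u; rewrite -[u]reprK -pi_scale scale1r. Qed.

Lemma qmod_scaleDr : right_distributive qmod_scale +%R.
Proof.
by move=> a u v; rewrite -[u]reprK -[v]reprK -raddfD -!pi_scale scalerDr raddfD.
Qed.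

Lemma qmod_scaleDl (u : qmod N) :
  {morph (fun a => qmod_scale a u) : a b / a + b}.
Proof. by move=> a b; rewrite -[u]reprK -!pi_scale scalerDl raddfD. Qed.

HB.instance Definition _ := GRing.Zmodule_isLmodule.Build R (qmod N)
  qmod_scaleA qmod_scale1 qmod_scaleDr qmod_scaleDl.

End QuotientModule.

Definition ideal (R : comPzRingType) (I : set R) : Prop :=
  submodule (I : set R^o).

Definition ideal_gen (R : comPzRingType) (G : set R) : set R :=
  span (G : set R^o).

Definition ideal_add (R : comPzRingType) (I J : set R) : set R :=
  [set a + b | a in I & b in J].

Definition ideal_mul (R : comPzRingType) (I J : set R) : set R :=
  ideal_gen [set a * b | a in I & b in J].

Definition ideal_exp (R : comPzRingType) (I : set R) (n : nat) : set R :=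
  iter n (ideal_mul I) setT.

Definition ideal_expz (R : comPzRingType) (I : set R) (n : int) : set R :=
  if n is Posz k then ideal_exp I k else setT.

(** [qring J] is R / J as a ring; like [qmod], it is total in [J : set R]. *)
Definition qring (R : comPzRingType) (J : set R) : Type :=
  @qmod R R^o J.

Section QuotientRing.
Variables (R : comPzRingType) (J : set R).

HB.instance Definition _ := GRing.Zmodule.on (qring J).
HB.instance Definition _ :
  EqQuotient R^o (Quotient.equiv (@span_zmod R R^o J)) (qring J) :=
  EqQuotient.on (qring J).
HB.instance Definition _ := ZmodQuotient.on (qring J).

Definition qring_pi (a : R) : qring J := \pi_(qring J) (a : R^o).

Lemma qring_piK (u : qring J) : qring_pi (repr u) = u.
Proof. exact: reprK. Qed.

Lemma qring_piD : {morph qring_pi : a b / a + b}.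
Proof. exact: (raddfD (\pi_(@qmod R R^o J))). Qed.

Definition qring_one : qring J := qring_pi 1.
Definition qring_mul (u v : qring J) : qring J :=
  qring_pi ((repr u : R) * (repr v : R)).

Lemma qring_piM : {morph qring_pi : a b / a * b >-> qring_mul a b}.
Proof.
move=> a b; rewrite /qring_mul.
have E (c e : R) : qring_pi (c * e) = qring_pi (c * repr (qring_pi e)).
  exact: (@pi_scale R R^o J c e).
by rewrite E mulrC [LHS]E mulrC.
Qed.

Lemma qring_mulA : associative qring_mul.
Proof.
by move=> u v w; rewrite -[u]qring_piK -[v]qring_piK -[w]qring_piK
  -!qring_piM mulrA.
Qed.

Lemma qring_mulC : commutative qring_mul.
Proof.
by move=> u v; rewrite -[u]qring_piK -[v]qring_piK -!qring_piM mulrC.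
Qed.

Lemma qring_mul1 : left_id qring_one qring_mul.
Proof. by move=> u; rewrite -[u]qring_piK -qring_piM mul1r. Qed.

Lemma qring_mulDl : left_distributive qring_mul +%R.
Proof.
by move=> u v w; rewrite -[u]qring_piK -[v]qring_piK -[w]qring_piK
  -qring_piD -!qring_piM mulrDl qring_piD.
Qed.

HB.instance Definition _ := GRing.Zmodule_isComPzRing.Build (qring J)
  qring_mulA qring_mulC qring_mul1 qring_mulDl.

End QuotientRing.

Definition is_max (S : set nat) (k : nat) : Prop :=
  S k /\ forall j, S j -> (j <= k)%N.

Definition submodule_chain (R : pzRingType) (V : lmodType R) (N M : set V)
    (k : nat) : Prop :=
  exists c : nat -> set V,
    [/\ c 0%N = N, c k = M,
        forall i, (i <= k)%N -> submodule (c i) &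
        forall i, (i < k)%N -> c i `<` c i.+1].

(** [len N M] is the length of M / N for submodules N, M of V with N contained
    in M: submodules of M / N are the submodules between N and M.  It is 0 by
    default if M / N does not have finite length. *)
Definition len (R : pzRingType) (V : lmodType R) (N M : set V) : nat :=
  xget 0%N (is_max (submodule_chain N M)).

Definition ideal_len (R : comPzRingType) (I J : set R) : nat :=
  len (I : set R^o) (J : set R^o).

Definition prime_ideal (R : comPzRingType) (I : set R) : Prop :=
  [/\ ideal I, ~ I 1 & forall a b, I (a * b) -> I a \/ I b].

Definition prime_chain (R : comPzRingType) (k : nat) : Prop :=
  exists p : nat -> set R,
    (forall i, (i <= k)%N -> prime_ideal (p i)) /\
    (forall i, (i < k)%N -> p i `<` p i.+1).

Definition krull_dim (R : comPzRingType) (d : nat) : Prop :=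
  is_max (prime_chain R) d.

Definition regular_seq (R : comPzRingType) (s : seq R) : Prop :=
  (forall i, (i < size s)%N ->
     GRing.lreg (qring_pi (ideal_gen [set` take i s]) s`_i)) /\
  ~ ideal_gen [set` s] 1.

Definition depth (R : comPzRingType) (I : set R) (k : nat) : Prop :=
  is_max [set size s | s in [set s : seq R | regular_seq s /\ [set` s] `<=` I]] k.

Definition noetherian (R : comPzRingType) : Prop :=
  forall I : set R, ideal I -> exists s : seq R, I = ideal_gen [set` s].

Definition maximal_ideal (R : comPzRingType) (m : set R) : Prop :=
  [/\ ideal m, ~ m 1 &
      forall J, ideal J -> m `<=` J -> ~ J 1 -> J = m].

Definition local_ring (R : comPzRingType) (m : set R) : Prop :=
  [/\ noetherian R, maximal_ideal m & forall m', maximal_ideal m' -> m' = m].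

Definition cohen_macaulay_local (R : comPzRingType) (m : set R) : Prop :=
  local_ring m /\ exists d, krull_dim R d /\ depth m d.

Definition radical (R : comPzRingType) (I : set R) : set R :=
  [set a | exists n, I (a ^+ n)].

Definition primary_ideal (R : comPzRingType) (I : set R) : Prop :=
  [/\ ideal I, ~ I 1 &
      forall a b, I (a * b) -> I a \/ exists n, I (b ^+ n)].

Definition primary_to (R : comPzRingType) (m I : set R) : Prop :=
  primary_ideal I /\ radical I = m.

Definition reduction (R : comPzRingType) (I J : set R) : Prop :=
  [/\ ideal J, J `<=` I &
      exists k, ideal_mul J (ideal_exp I k) = ideal_exp I k.+1].

Definition minimal_reduction (R : comPzRingType) (I J : set R) : Prop :=
  reduction I J /\ forall J', reduction I J' -> J' `<=` J -> J' = J.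

Definition superficial (R : comPzRingType) (I2 I1 : set R) (x : R) : Prop :=
  I2 x /\ exists r0, (0 < r0)%N /\
    forall r s, (r0 <= r)%N ->
      [set x * a | a in setT] `&` ideal_mul (ideal_exp I1 s) (ideal_exp I2 r) =
      [set x * a | a in ideal_mul (ideal_exp I1 s) (ideal_exp I2 r.-1)].

Definition superficial_seq (R : comPzRingType) (I2 I1 : set R) (s : seq R) :
    Prop :=
  [set` s] `<=` I2 /\
  forall i, (i < size s)%N ->
    let pi := qring_pi (ideal_gen [set` take i s]) in
    superficial (pi @` I2) (pi @` I1) (pi s`_i).

Definition ksub (d i : nat) := {A : {set 'I_d} | #|A| == i}.

(** The free module of rank binomial(d, i) with basis e_A, for A a subset of
    cardinality i; an element is the function of its coordinates. *)
Definition koszul (R : comPzRingType) (d i : nat) : Type :=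
  {ffun ksub d i -> R^o}.

(** The coordinate form of the usual differential: e_A is sent to the sum over
    j in A of (-1) ^ #{k in A | k < j} x_j e_(A \ j). *)
Definition koszul_diff (R : comPzRingType) (d : nat) (x : d.-tuple R) (i : nat)
    (f : koszul R d i.+1) : koszul R d i :=
  [ffun B : ksub d i => \sum_(A : ksub d i.+1)
     \sum_(j : 'I_d | (j \in val A) && (val B == val A :\ j)%SET)
       (-1) ^+ #|[set k in val A | (k < j)%N]%SET| * tnth x j * f A].

(** [cplx d I1 I2 n i] is the degree i term (R / I1 I2^(n-i))^binomial(d, i) of
    the complex C(1, n), indexed like [koszul R d i]. *)
Definition cplx_ideal (R : comPzRingType) (I1 I2 : set R) (n : int) (i : nat) :
    set R :=
  ideal_mul I1 (ideal_expz I2 (n - i%:Z)).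

Definition cplx (R : comPzRingType) (d : nat) (I1 I2 : set R) (n : int)
    (i : nat) : Type :=
  {ffun ksub d i -> @qmod R R^o (cplx_ideal I1 I2 n i)}.

HB.instance Definition _ (R : comPzRingType) (d : nat) (I1 I2 : set R) (n : int)
  (i : nat) := GRing.Lmodule.on (cplx d I1 I2 n i).

Definition cplx_proj (R : comPzRingType) (d : nat) (I1 I2 : set R) (n : int)
    (i : nat) (f : koszul R d i) : cplx d I1 I2 n i :=
  [ffun A => \pi_(@qmod R R^o (cplx_ideal I1 I2 n i)) (f A)].

(** The induced differential is computed on representatives; by [cplx_diffE]
    the choice does not matter when the x_j lie in I2. *)
Definition cplx_diff (R : comPzRingType) (d : nat) (I1 I2 : set R)
    (x : d.-tuple R) (n : int) (i : nat) (f : cplx d I1 I2 n i.+1) :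
    cplx d I1 I2 n i :=
  cplx_proj I1 I2 n (koszul_diff x [ffun A => repr (f A)]).

Lemma cplx_idealM (R : comPzRingType) (I1 I2 : set R) (n : int) (i : nat)
    (x u : R) :
  I2 x -> cplx_ideal I1 I2 n i.+1 u -> cplx_ideal I1 I2 n i (x * u).
Proof.
move=> I2x.
have I2xb b : ideal_expz I2 (n - i.+1%:Z) b ->
    ideal_expz I2 (n - i%:Z) (x * b).
  have -> : n - i%:Z = (n - i.+1%:Z) + 1.
    by rewrite -addn1 PoszD opprD addrA subrK.
  case: (n - i.+1%:Z) => [k|[|k]] //= Ib.
  rewrite addn1 /= => N [_]; apply.
  by exists x => //; exists b.
set N : set R^o := [set v | cplx_ideal I1 I2 n i (x * (v : R))].
have Nsub : submodule N.
  have [L0 L] := @submodule_span R R^o [set a * b | a in I1 &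
    b in ideal_expz I2 (n - i%:Z)].
  split=> [|a v w]; rewrite !inE in L0 *; first by rewrite /N /= mulr0.
  move=> Nv Nw; rewrite /N /=.
  have := L a (x * v) (x * w); rewrite !inE => /(_ Nv Nw).
  by rewrite mulrDr /= -[a *: (v : R^o)]/(a * v) mulrCA.
move=> Lu; apply: (Lu N); split=> // _ [a I1a [b Ib <-]].
rewrite /N /= mulrCA => M [_]; apply.
by exists a => //; exists (x * b) => //; apply: I2xb.
Qed.

Lemma cplx_diffE (R : comPzRingType) (d : nat) (I1 I2 : set R)
    (x : d.-tuple R) (n : int) (i : nat) (f : koszul R d i.+1) :
  [set` x] `<=` I2 ->
  cplx_diff x (cplx_proj I1 I2 n f) = cplx_proj I1 I2 n (koszul_diff x f).
Proof.
move=> xI2; apply/ffunP => B; rewrite !ffunE; apply/eqP.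
rewrite eq_pi_qmod -sumrB; elim/big_rec: _ => [|A y _ yL].
  exact: (submodule_span _).1.
rewrite -[_ \in _]/(_ \in @spanb R R^o _) rpredD // -sumrB.
apply: rpred_sum => j _; rewrite -mulrBr -mulrA.
apply: (@rpredZ R R^o _ ((-1) ^+ _)).
rewrite -[_ \in _]/(_ \in @span R R^o _) inE span_id; last first.
  exact: submodule_span.
apply: cplx_idealM; first exact/xI2/mem_tnth.
have : (\pi_(@qmod R R^o (cplx_ideal I1 I2 n i.+1))
  (repr (cplx_proj I1 I2 n f A)) ==
  \pi_(@qmod R R^o (cplx_ideal I1 I2 n i.+1)) (f A)) by rewrite reprK ffunE.
rewrite eq_pi_qmod inE span_id; first by rewrite !ffunE.
exact: submodule_span.
Qed.

Definition cycles (R : comPzRingType) (d : nat) (I1 I2 : set R)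
    (x : d.-tuple R) (n : int) (i : nat) : set (cplx d I1 I2 n i) :=
  match i return set (cplx d I1 I2 n i) with
  | 0%N => setT
  | i'.+1 => [set f | cplx_diff x f = 0]
  end.

Definition boundaries (R : comPzRingType) (d : nat) (I1 I2 : set R)
    (x : d.-tuple R) (n : int) (i : nat) : set (cplx d I1 I2 n i) :=
  range (@cplx_diff R d I1 I2 x n i).

Definition hlen (R : comPzRingType) (d : nat) (I1 I2 : set R)
    (x : d.-tuple R) (i : nat) (n : int) : nat :=
  len (@boundaries R d I1 I2 x n i) (@cycles R d I1 I2 x n i).

Definition bdiff (f : int -> rat) (n : int) : rat := f n - f (n - 1).

Definition hilb (R : comPzRingType) (I1 I2 : set R) (n : int) : nat :=
  ideal_len (ideal_mul I1 (ideal_expz I2 n)) setT.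

(** [P] is the polynomial that agrees with [hilb I1 I2] for large n; it has
    rational coefficients, since it is integer valued at large integers. *)
Definition hilb_poly (R : comPzRingType) (I1 I2 : set R) (P : {poly rat}) :
    Prop :=
  exists n0 : int, forall n : int, (n0 <= n)%R -> P.[n%:~R] = (hilb I1 I2 n)%:R.

(* Main.v *)
(** Write L(n) = I1 I2^n and X = (x_1, ..., x_d).  The terms of C(1, n) have
    length binom(d, i) H(n - i), so its Euler characteristic is Delta^d H(n).
    A maximal regular sequence in m consists of elements with powers in X, hence
    the Koszul complex of x over R is acyclic (depth sensitivity), and by
    Nakayama so are those of x_1, ..., x_p; thus x is a regular sequence.
    Superficiality then gives (L(n) + (x_1, ..., x_p)) : x_(p+1) =
    L(n - 1) + (x_1, ..., x_p) for large n, and building the complex as an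
    iterated mapping cone kills H_i(C(1, n)) for i > 0 and large n.  As
    L(n) lies in X for large n, Delta^d P = Delta^d H = len(R / X) there, hence
    Delta^d P is this constant everywhere.  Finally H_0(C(1, n)) =
    R / (L(n) + X), and H_1(C(1, n)) is (X cap L(n)) / X L(n - 1) because
    H_1(x; R) = 0. *)

From HB Require Import structures.
Require Import Defs.
From mathcomp Require Import all_boot all_order all_algebra.
From mathcomp Require Import all_classical ring.

Set Implicit Arguments.
Unset Strict Implicit.
Unset Printing Implicit Defensive.

Import Order.TTheory GRing.Theory Num.Theory.
Local Open Scope classical_set_scope.
Local Open Scope ring_scope.
Local Open Scope quotient_scope.

(** The obstacle is that the $x_i$ are not known at the outset to form a regular sequence:
    superficiality speaks only of large powers of $I_2$, and depth provides a different regular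
    sequence in $\mathfrak m$. The two inputs meet in the colon condition. Superficiality turns
    $x_{p+1}c\in L(n)+(x_1,\dots,x_p)$ into $x_{p+1}(c-l)\in(x_1,\dots,x_p)$ with $l\in L(n-1)$, and
    regularity cancels $x_{p+1}$. The mapping cone needs this in degree one, where exactness in
    positive degrees says nothing about $H_0$. All Koszul complexes live in one module, the
    functions on subsets of the index set; degree and number of generators are support conditions.
    $C(1,n)$ is treated as the quotient by a subcomplex, so its homology lengths are computed
    between submodules of free modules. Since [len] is 0 on infinite length, additivity requires
    finiteness first. The source of finiteness is that an ideal containing a power of each element
    of $\mathfrak m$ has finite colength. *)

Local Notation span := Defs.span.

(** * Length *)

Section Length.
Variable R : pzRingType.
Implicit Types V W : lmodType R.

Lemma submoduleP V (N : set V) :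
  submodule N <-> N 0 /\ forall a u v, N u -> N v -> N (a *: u + v).
Proof.
split=> [[N0 NL]|[N0 NL]]; first rewrite inE in N0.
  split=> // a u v Nu Nv; have := NL a u v; rewrite !inE; exact.
by split=> [|a u v]; rewrite !inE //; apply: NL.
Qed.

Lemma submodule0 V (N : set V) : submodule N -> N 0.
Proof. by case/submoduleP. Qed.

Lemma submoduleL V (N : set V) a u v :
  submodule N -> N u -> N v -> N (a *: u + v).
Proof. by case/submoduleP => _; apply. Qed.

Arguments submoduleL [V N] a [u v].

Lemma submoduleD V (N : set V) u v : submodule N -> N u -> N v -> N (u + v).
Proof. by move=> sN Nu Nv; rewrite -[u]scale1r; apply: submoduleL. Qed.

Lemma submoduleZ V (N : set V) a u : submodule N -> N u -> N (a *: u).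
Proof.
by move=> sN Nu; rewrite -[_ *: _]addr0; apply: submoduleL => //; apply: submodule0.
Qed.

Arguments submoduleZ [V N] a [u].

Lemma submoduleN V (N : set V) u : submodule N -> N u -> N (- u).
Proof. by move=> sN Nu; rewrite -scaleN1r; apply: submoduleZ. Qed.

Lemma submoduleB V (N : set V) u v : submodule N -> N u -> N v -> N (u - v).
Proof. by move=> sN Nu Nv; apply: submoduleD => //; apply: submoduleN. Qed.

Lemma submodule_sum V (N : set V) (I : Type) (r : seq I) (Q : pred I)
    (F : I -> V) :
  submodule N -> (forall i, Q i -> N (F i)) -> N (\sum_(i <- r | Q i) F i).
Proof.
move=> sN NF; elim/big_ind: _ => //; first exact: submodule0.
by move=> u v; apply: submoduleD.
Qed.

Lemma submodule_setT V : submodule [set: V].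
Proof. exact/submoduleP. Qed.

Lemma submodule_setI V (N M : set V) :
  submodule N -> submodule M -> submodule (N `&` M).
Proof.
move=> sN sM; apply/submoduleP; split=> [|a u v [Nu Mu] [Nv Mv]].
  by split; apply: submodule0.
by split; apply: submoduleL.
Qed.

Definition smod_add V (N M : set V) : set V := [set u + v | u in N & v in M].

Lemma submodule_add V (N M : set V) :
  submodule N -> submodule M -> submodule (smod_add N M).
Proof.
move=> sN sM; apply/submoduleP; split.
  by exists 0; [apply: submodule0|exists 0; [apply: submodule0|rewrite addr0]].
move=> a _ _ [u Nu [v Mv <-]] [u' Nu' [v' Mv' <-]].
exists (a *: u + u'); first exact: submoduleL.
exists (a *: v + v'); first exact: submoduleL.
by rewrite scalerDr addrACA.
Qed.

Lemma smod_addl V (N M : set V) : submodule M -> N `<=` smod_add N M.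
Proof.
by move=> sM u Nu; exists u => //; exists 0; [apply: submodule0|rewrite addr0].
Qed.

Lemma smod_addr V (N M : set V) : submodule N -> M `<=` smod_add N M.
Proof.
by move=> sN u Mu; exists 0; [apply: submodule0|exists u => //; rewrite add0r].
Qed.

Lemma smod_add_min V (N M K : set V) :
  submodule K -> N `<=` K -> M `<=` K -> smod_add N M `<=` K.
Proof.
by move=> sK NK MK _ [u Nu [v Mv <-]]; apply: submoduleD; [|apply: NK|apply: MK].
Qed.

Lemma smod_addS V (N N' M M' : set V) :
  N `<=` N' -> M `<=` M' -> smod_add N M `<=` smod_add N' M'.
Proof.
move=> NN' MM' _ [u Nu [v Mv <-]].
by exists u; [apply: NN'|exists v => //; apply: MM'].
Qed.

Lemma submodule_preimage V W (f : {linear V -> W}) (N : set W) :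
  submodule N -> submodule (f @^-1` N).
Proof.
move=> sN; apply/submoduleP; split; first by rewrite /= linear0; apply: submodule0.
by move=> a u v Nu Nv; rewrite /= linearP; apply: submoduleL.
Qed.

Lemma submodule_image V W (f : {linear V -> W}) (N : set V) :
  submodule N -> submodule (f @` N).
Proof.
move=> sN; apply/submoduleP; split.
  by exists 0; [apply: submodule0|rewrite linear0].
move=> a _ _ [u Nu <-] [v Nv <-]; exists (a *: u + v); first exact: submoduleL.
by rewrite linearP.
Qed.

Lemma chain0 V (N M : set V) :
  submodule_chain N M 0 <-> N = M /\ submodule N.
Proof.
split=> [[c [cN cM sc _]]|[-> sM]]; last by exists (fun=> M); split.
by split; [rewrite -cN -cM|rewrite -cN; exact: sc].
Qed.

Lemma chainS V (N M : set V) k :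
  submodule_chain N M k.+1 <->
  exists K, [/\ submodule_chain N K k, K `<` M & submodule M].
Proof.
split=> [[c [cN cM sc pc]]|[K [[c [cN cK sc pc]] KM sM]]].
  exists (c k); split; last by rewrite -cM; apply: sc.
    by exists c; split=> // i ik; [apply: sc; apply: leqW|apply: pc; apply: leqW].
  by rewrite -cM; apply: pc.
exists (fun i => if (i <= k)%N then c i else M); split=> //=.
- by rewrite ltnn.
- by move=> i _; case: leqP => [ik|_]; [exact: sc|].
move=> i ik; rewrite -ltnS ik; case: (ltnP i k) => [|ki]; first exact: pc.
by have -> : i = k; [apply/eqP; rewrite eqn_leq ki andbT|rewrite cK].
Qed.

Lemma chain_cat V (N K M : set V) a b : submodule_chain N K a ->
  submodule_chain K M b -> submodule_chain N M (a + b).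
Proof.
move=> NK; elim: b M => [|b IH] M; first by case/chain0 => <-; rewrite addn0.
case/chainS => L [/IH NL LM sM]; rewrite addnS.
by apply/chainS; exists L.
Qed.

Lemma chain_sub V (N M : set V) k : submodule_chain N M k ->
  [/\ N `<=` M, submodule N & submodule M].
Proof.
elim: k M => [|k IH] M; first by case/chain0 => <-; split.
by case/chainS => K [/IH[NK sN sK] [KM _] sM]; split=> // u /NK /KM.
Qed.

(** Strictness is asked only between [N] and [M], because the maps it serves, $K\mapsto f(K)+N'$ and
    $K\mapsto M\cap f^{-1}(K)$, are injective only on such submodules. *)
Lemma chain_map V W (phi : set V -> set W) (N M : set V) k :
    (forall K, submodule K -> N `<=` K -> K `<=` M -> submodule (phi K)) ->
    (forall K L, submodule K -> submodule L -> N `<=` K -> K `<` L -> L `<=` M ->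
       phi K `<` phi L) ->
  submodule_chain N M k -> submodule_chain (phi N) (phi M) k.
Proof.
elim: k M => [|k IH] M sphi pphi.
  by case/chain0 => NM sN; apply/chain0; rewrite NM; split=> //; apply: sphi; rewrite -NM.
case/chainS => K [cK KM sM]; have [NK sN sK] := chain_sub cK.
apply/chainS; exists (phi K); split.
- apply: IH => // [L sL NL LK|L L' sL sL' NL LL' LK].
    by apply: sphi => //; apply: subset_trans KM.1.
  by apply: pphi => //; apply: subset_trans KM.1.
- exact: pphi.
- by apply: sphi => //; apply: subset_trans KM.1.
Qed.

(** Dropping the repetitions of a weakly increasing sequence leaves a chain with one step per strict
    inclusion. *)
Lemma chain_refine V (c : nat -> set V) k :
    (forall i, (i <= k)%N -> submodule (c i)) ->
    (forall i, (i < k)%N -> c i `<=` c i.+1) ->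
  submodule_chain (c 0%N) (c k) (\sum_(i < k) `[< c i `<` c i.+1 >])%N.
Proof.
elim: k => [|k IH] sc ic.
  by rewrite big_ord0; apply/chain0; split=> //; apply: sc.
have cH := IH (fun i ik => sc i (leqW ik)) (fun i ik => ic i (leqW ik)).
rewrite big_ord_recr /=; case: asboolP => [lt|nlt].
  by rewrite addn1; apply/chainS; exists (c k); split=> //; apply: sc.
rewrite addn0; suff -> : c k.+1 = c k by [].
apply/seteqP; split; last exact: ic.
by apply: contrapT => h; apply: nlt; split=> //; apply: ic.
Qed.

(** Relational form of [len]: it asserts that the maximum exists, which an equation on [len] does
    not, in view of the default value 0. *)
Definition has_len V (N M : set V) k := is_max (submodule_chain N M) k.

Definition flen V (N M : set V) := exists k, has_len N M k.

Lemma is_max_uniq (S : set nat) k l : is_max S k -> is_max S l -> k = l.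
Proof.
by move=> [Sk mk] [Sl ml]; apply/eqP; rewrite eqn_leq mk // ml.
Qed.

Lemma has_lenE V (N M : set V) k : has_len N M k -> len N M = k.
Proof. by move=> h; exact: is_max_uniq (xgetI _ h) h. Qed.

Lemma flenP V (N M : set V) : flen N M -> has_len N M (len N M).
Proof. by case=> k h; rewrite (has_lenE h). Qed.

Lemma chain_ex V (N M : set V) : submodule N -> submodule M -> N `<=` M ->
  exists k, submodule_chain N M k.
Proof.
move=> sN sM NM; have [MN|nMN] := pselect (M `<=` N).
  by exists 0%N; apply/chain0; split=> //; apply/seteqP.
exists 1%N; apply/chainS; exists N; split=> //; exact/chain0.
Qed.

Lemma flen_bounded V (N M : set V) b :
    submodule N -> submodule M -> N `<=` M ->
    (forall k, submodule_chain N M k -> (k <= b)%N) ->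
  flen N M.
Proof.
move=> sN sM NM bd; have [k0 ck0] := chain_ex sN sM NM.
have ex : exists k, `[< submodule_chain N M k >] by exists k0; apply/asboolP.
have ub k : `[< submodule_chain N M k >] -> (k <= b)%N by move/asboolP; apply: bd.
case: (ex_maxnP ex ub) => k /asboolP ck mk; exists k; split=> // j cj.
by apply: mk; apply/asboolP.
Qed.

Lemma flen_sub V (N K M : set V) : submodule K -> N `<=` K -> K `<=` M ->
  flen N M -> flen N K /\ flen K M.
Proof.
move=> sK NK KM [b [cNM mb]]; have [_ sN sM] := chain_sub cNM.
have [j cj] := chain_ex sN sK NK; have [j' cj'] := chain_ex sK sM KM.
split; apply: (@flen_bounded _ _ _ b) => // k ck; apply: (leq_trans _ (mb _ _)).
- exact: leq_addr j' k.
- exact: chain_cat ck cj'.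
- exact: leq_addl j k.
- exact: chain_cat cj ck.
Qed.

(** For the upper bound, a chain from [N] to [M] has two traces, its intersections and its sums with
    [K]; each strict step stays strict in at least one of them. *)
Lemma has_len_add V (N K M : set V) a b :
  has_len N K a -> has_len K M b -> has_len N M (a + b).
Proof.
move=> [cNK ma] [cKM mb]; split; first exact: chain_cat cNK cKM.
have [NK sN sK] := chain_sub cNK; have [KM _ sM] := chain_sub cKM.
move=> k [c [cN cM sc pc]].
have c1 : submodule_chain (c 0%N `&` K) (c k `&` K)
    (\sum_(i < k) `[< c i `&` K `<` c i.+1 `&` K >])%N.
  apply: (@chain_refine _ (fun i => c i `&` K)) => [i ik|i ik u [cu Ku]].
    exact/submodule_setI/sK/sc.
  by split=> //; apply: (pc i ik).1.
have c2 : submodule_chain (smod_add (c 0%N) K) (smod_add (c k) K)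
    (\sum_(i < k) `[< smod_add (c i) K `<` smod_add (c i.+1) K >])%N.
  apply: (@chain_refine _ (fun i => smod_add (c i) K)) => i ik.
    exact/submodule_add/sK/sc.
  by apply: smod_addS => //; apply: (pc i ik).1.
have e1 : c 0%N `&` K = N by rewrite cN; apply: setIidl.
have e2 : c k `&` K = K by rewrite cM; apply: setIidr.
have e3 : smod_add (c 0%N) K = K.
  rewrite cN; apply/seteqP; split; last exact: smod_addr.
  exact: smod_add_min.
have e4 : smod_add (c k) K = M.
  rewrite cM; apply/seteqP; split; last exact: smod_addl.
  exact: smod_add_min.
rewrite e1 e2 in c1; rewrite e3 e4 in c2.
apply: leq_trans (leq_add (ma _ c1) (mb _ c2)).
rewrite -big_split /= -[leqLHS]card_ord -sum1_card.
apply: leq_sum => -[i ik] _ /=.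
case: asboolP => [_|n1]; first exact: leq_addr.
case: asboolP => [_|n2]; first exact: leq_addl.
(* Modular law: if neither trace grows, an element $u$ of the larger term is $v+w$ with $v$ in the
   smaller term and $w\in K$; then $w=u-v$ lies in the smaller term too. *)
have [cc ncc] := pc i ik; case: ncc => u cu.
have sci := sc _ (ltnW ik); have sci1 := sc _ ik.
have [v cv [w Kw vw]] : smod_add (c i) K u.
  apply: contrapT => nu; apply: n2; split; first exact: smod_addS.
  by move=> /(_ u) h; apply: nu; apply: h; apply: smod_addl.
have ww : (c i `&` K) w.
  apply: contrapT => nw; apply: n1; split; first exact: setSI.
  move=> /(_ w) h; apply: nw; apply: h; split=> //.
  have -> : w = u - v by rewrite -vw addrC addKr.
  by apply: submoduleB => //; apply: cc.
by rewrite -vw; apply: submoduleD => //; exact: ww.1.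
Qed.

Lemma flen_trans V (N K M : set V) : flen N K -> flen K M -> flen N M.
Proof. by case=> a ha [b hb]; exists (a + b)%N; apply: has_len_add hb. Qed.

Lemma len_add V (N K M : set V) : submodule K -> N `<=` K -> K `<=` M ->
  flen N M -> len N M = (len N K + len K M)%N.
Proof.
move=> sK NK KM fl; have [/flenP h1 /flenP h2] := flen_sub sK NK KM fl.
by apply: has_lenE; exact: has_len_add h1 h2.
Qed.

Lemma has_lenxx V (N : set V) : submodule N -> has_len N N 0.
Proof.
move=> sN; split=> [|k]; first exact/chain0.
case: k => // k /chainS[K [/chain_sub[NK _ _] KN _]].
by case: KN => _; case.
Qed.

Lemma len_xx V (N : set V) : submodule N -> len N N = 0%N.
Proof. by move/has_lenxx/has_lenE. Qed.

(** [f] induces an isomorphism [M / N -> M' / N']. *)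
Lemma chain_iso V W (f : {linear V -> W}) (N M : set V) (N' M' : set W) k :
    submodule N -> submodule M -> submodule N' ->
    M' = smod_add (f @` M) N' -> N = M `&` f @^-1` N' ->
  submodule_chain N M k <-> submodule_chain N' M' k.
Proof.
move=> sN sM sN' eM' eN.
have NM : N `<=` M by rewrite eN => u [].
have sM' : submodule M' by rewrite eM'; apply/submodule_add/sN'/submodule_image.
split=> ck.
  have -> : N' = smod_add (f @` N) N'.
    apply/seteqP; split; first exact/smod_addr/submodule_image.
    by apply: smod_add_min => // _ [u Nu <-]; move: Nu; rewrite eN => -[].
  rewrite eM'; apply: (chain_map (phi := fun K => smod_add (f @` K) N')) ck.
    by move=> K sK _ _; apply/submodule_add/sN'/submodule_image.
  move=> K L sK sL NK [KL nLK] LM; split.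
    by apply: smod_addS => // _ [u Ku <-]; exists u => //; apply: KL.
  move=> h; apply: nLK => u Lu.
  have [_ [v Kv <-] [w N'w e]] : smod_add (f @` K) N' (f u).
    by apply: h; apply: smod_addl => //; exists u.
  rewrite -(subrK v u); apply: submoduleD => //; apply: NK; rewrite eN.
  split; first by apply: submoduleB => //; apply: LM => //; apply: KL.
  by rewrite /= linearB /= -e addrC addKr.
have eM : M = M `&` f @^-1` M'.
  apply/esym/setIidl => u Mu; rewrite /= eM'.
  by apply: smod_addl => //; exists u.
rewrite eN [X in submodule_chain _ X]eM.
apply: (chain_map (phi := fun K => M `&` f @^-1` K)) ck.
  by move=> K sK _ _; apply: submodule_setI => //; apply: submodule_preimage.
move=> K L sK sL NK [KL nLK] LM; split.
  by move=> u [Mu Ku]; split=> //; apply: KL.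
move=> h; apply: nLK => u Lu.
have := LM u Lu; rewrite eM' => -[_ [v Mv <-] [w N'w e]].
have [_ Kv] : (M `&` f @^-1` K) v.
  apply: h; split=> //=; rewrite -(addrK w (f v)) e.
  by apply: submoduleB => //; apply: KL; apply: NK.
by rewrite -e; apply: submoduleD => //; apply: NK.
Qed.

Lemma has_len_iso V W (f : {linear V -> W}) (N M : set V) (N' M' : set W) k :
    submodule N -> submodule M -> submodule N' ->
    M' = smod_add (f @` M) N' -> N = M `&` f @^-1` N' ->
  has_len N M k <-> has_len N' M' k.
Proof.
move=> sN sM sN' eM' eN; split=> -[c mk]; split.
- exact/(chain_iso _ sN sM sN' eM' eN).
- by move=> j /(chain_iso _ sN sM sN' eM' eN); apply: mk.
- exact/(chain_iso _ sN sM sN' eM' eN).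
- by move=> j /(chain_iso _ sN sM sN' eM' eN); apply: mk.
Qed.

Lemma len_iso V W (f : {linear V -> W}) (N M : set V) (N' M' : set W) :
    submodule N -> submodule M -> submodule N' ->
    M' = smod_add (f @` M) N' -> N = M `&` f @^-1` N' ->
  len N M = len N' M'.
Proof.
move=> sN sM sN' eM' eN; rewrite /len; congr (xget 0%N _).
by apply/funext => k; apply/propext/(has_len_iso _ sN sM sN' eM' eN).
Qed.

End Length.
Arguments submoduleL [R V N] a [u v].
Arguments submoduleZ [R V N] a [u].

(** * Finiteness over noetherian local rings *)

Section Span.
Variables (R : pzRingType) (V : lmodType R).
Implicit Types (G N : set V) (s : seq V).

Lemma mem_span G u : G u -> span G u.
Proof. by move=> Gu N [_]; apply. Qed.

Lemma sub_span G : G `<=` span G.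
Proof. by move=> u; exact: mem_span. Qed.

Lemma span_min G N : submodule N -> G `<=` N -> span G `<=` N.
Proof. by move=> sN GN u; apply. Qed.

Lemma span_cons a s u : span [set` a :: s] u ->
  exists r w, span [set` s] w /\ u = r *: a + w.
Proof.
have ss := @submodule_span R V [set` s].
pose N := [set u | exists r w, span [set` s] w /\ u = r *: a + w].
apply: (@span_min _ N).
  apply/submoduleP; split.
    by exists 0, 0; rewrite scale0r addr0; split=> //; apply: submodule0.
  move=> c _ _ [r [w [sw ->]]] [r' [w' [sw' ->]]].
  exists (c * r + r'), (c *: w + w'); split; first exact (submoduleL c ss sw sw').
  by rewrite scalerDr scalerA addrACA scalerDl.
move=> v /=; rewrite inE => /predU1P[->|sv].
  by exists 1, 0; rewrite scale1r addr0; split=> //; apply: submodule0.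
by exists 0, v; rewrite scale0r add0r; split=> //; exact: mem_span.
Qed.

Lemma span_nil u : span [set` [::] : seq V] u -> u = 0.
Proof.
apply: (@span_min _ [set 0]) => //; apply/submoduleP; split=> //.
by move=> a _ _ -> ->; rewrite scaler0 addr0.
Qed.

End Span.

Lemma idealM (R : comPzRingType) (I : set R) a b : ideal I -> I b -> I (a * b).
Proof. by move=> iI Ib; have := @submoduleZ R R^o I a b iI Ib. Qed.

Lemma sub_ideal_gen (R : comPzRingType) (G : set R) : G `<=` ideal_gen G.
Proof. exact: (@sub_span R R^o). Qed.

Lemma ideal_gen_min (R : comPzRingType) (G I : set R) :
  ideal I -> G `<=` I -> ideal_gen G `<=` I.
Proof. exact: (@span_min R R^o). Qed.

Lemma ideal_gen_ideal (R : comPzRingType) (G : set R) : ideal (ideal_gen G).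
Proof. exact: (@submodule_span R R^o). Qed.

Lemma ideal_principal (R : comPzRingType) (b : R) :
  ideal [set a * b | a in setT].
Proof.
apply/submoduleP; split; first by exists 0; rewrite ?mul0r.
move=> a _ _ [v _ <-] [w _ <-]; exists (a * v + w) => //.
by rewrite mulrDl -mulrA.
Qed.

Section Noetherian.
Variables (R : comPzRingType) (m : set R).
Hypothesis noethR : noetherian R.

(** A counterexample would start an infinite strictly ascending chain of counterexamples; the union
    of the chain is finitely generated, hence reached at a finite stage. *)
Lemma noetherian_ind (P : set R -> Prop) :
    (forall I, ideal I -> (forall J, ideal J -> I `<` J -> P J) -> P I) ->
  forall I, ideal I -> P I.
Proof.
move=> step I0 iI0; apply: contrapT => nP0.
pose T := {I : set R | ideal I /\ ~ P I}.
have next (I : T) : exists J : T, sval I `<` sval J.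
  apply: contrapT => h; apply: (svalP I).2; apply: step.
    exact: (svalP I).1.
  move=> J iJ IJ; apply: contrapT => nPJ; apply: h.
  by exists (exist _ J (conj iJ nPJ)).
pose c n : T := iter n (fun I => projT1 (cid (next I))) (exist _ I0 (conj iI0 nP0)).
have cS n : sval (c n) `<` sval (c n.+1) by rewrite /=; case: cid.
have cle i j : (i <= j)%N -> sval (c i) `<=` sval (c j).
  by move/subnK <-; elim: (j - i)%N => [|k IH] // u /IH; apply: (cS _).1.
pose U : set R := [set u | exists n, sval (c n) u].
have iU : ideal U.
  apply/submoduleP; split.
    by exists 0%N; apply: (@submodule0 R R^o); apply: (svalP (c 0%N)).1.
  move=> a u v [i ciu] [j cjv]; exists (maxn i j).
  apply: (@submoduleL R R^o); first exact: (svalP (c (maxn i j))).1.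
    exact: (cle i _ (leq_maxl i j)).
  exact: (cle j _ (leq_maxr i j)).
have [s Us] := noethR iU.
have [N sN] : exists N, [set` s] `<=` sval (c N).
  have : [set` s] `<=` U by rewrite Us; exact: sub_ideal_gen.
  elim: s {Us} => [|a s IH] sU; first by exists 0%N.
  have [i ca] : U a by apply: sU; rewrite /= mem_head.
  have [u su|j cs] := IH; first by apply: sU; rewrite /= inE su orbT.
  exists (maxn i j) => u /=; rewrite inE => /predU1P[->|su].
    exact: (cle i _ (leq_maxl i j)).
  by apply: (cle j _ (leq_maxr i j)); apply: cs.
apply: (cS N).2 => u cu.
have : U u by exists N.+1.
rewrite Us; apply: (@span_min R R^o) => //; exact: (svalP (c N)).1.
Qed.

Lemma ex_maximal_ideal J : ideal J -> ~ J 1 ->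
  exists2 M : set R, maximal_ideal M & J `<=` M.
Proof.
move: J; apply: (noetherian_ind (P := fun J => ~ J 1 ->
  exists2 M : set R, maximal_ideal M & J `<=` M)) => J iJ IH nJ1.
have [mJ|nmJ] := pselect (maximal_ideal J); first by exists J.
have [K [iK JK nK1 nKJ]] :
    exists K, [/\ ideal K, J `<=` K, ~ K 1 & K <> J].
  apply: contrapT => h; apply: nmJ; split=> // K iK JK nK1.
  by apply: contrapT => nKJ; apply: h; exists K.
have [|M mM KM] := IH K iK _ nK1; last by exists M => // u /JK /KM.
by split=> // KJ; apply: nKJ; apply/seteqP.
Qed.

(** Induction on the list of coordinates allowed to be nonzero: the values of the first coordinate
    form a finitely generated ideal, whose generators are lifted, and the elements where it vanishes
    fall under the induction. Nakayama needs this for modules of cycles. *)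
Lemma ffun_fg (T : finType) (N : set {ffun T -> R^o}) : submodule N ->
  exists2 s : seq {ffun T -> R^o}, [set` s] `<=` N & N `<=` span [set` s].
Proof.
move=> sN.
suff H (r : seq T) : forall N' : set {ffun T -> R^o}, submodule N' ->
    (forall f t, N' f -> t \notin r -> f t = 0) ->
    exists2 s : seq {ffun T -> R^o}, [set` s] `<=` N' & N' `<=` span [set` s].
  by apply: (H (enum T)) => // f t _; rewrite mem_enum.
elim: r => [|t r IH] M sM supp.
  exists [::] => // f Mf; have -> : f = 0; last exact (submodule0 (@submodule_span R _ _)).
  by apply/ffunP => t; rewrite ffunE; apply: supp.
pose M0 : set {ffun T -> R^o} := [set f | M f /\ f t = 0].
have sM0 : submodule M0.
  apply/submoduleP; split; first by split; [exact: submodule0|rewrite ffunE].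
  move=> a f g [Mf f0] [Mg g0]; split; first exact: submoduleL.
  by rewrite !ffunE f0 g0 scaler0 addr0.
have [|s0 s0M Ms0] := IH M0 sM0.
  move=> f u [Mf f0] ur; have [->//|ut] := eqVneq u t.
  by apply: supp => //; rewrite inE negb_or ut.
pose I : set R := [set f t | f in M].
have iI : ideal I.
  apply/submoduleP; split; first by exists 0; [exact: submodule0|rewrite ffunE].
  move=> a _ _ [f Mf <-] [g Mg <-]; exists (a *: f + g); first exact: submoduleL.
  by rewrite !ffunE.
have [l Il] := noethR iI.
have [s1 s1M ls1] : exists2 s1 : seq {ffun T -> R^o}, [set` s1] `<=` M &
    forall a, a \in l -> exists2 f, f \in s1 & f t = a.
  have : [set` l] `<=` I by rewrite Il; exact: sub_ideal_gen.
  elim: l {Il} => [|a l IHl] lI; first by exists [::].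
  have [u lu|s1 s1M ls1] := IHl; first by apply: lI; rewrite /= inE lu orbT.
  have [f Mf fa] : I a by apply: lI; rewrite /= mem_head.
  exists (f :: s1) => [g /=|b].
    by rewrite inE => /predU1P[->//|]; apply: s1M.
  rewrite inE => /predU1P[->|/ls1[g gs <-]]; first by exists f; rewrite ?mem_head.
  by exists g; rewrite // inE gs orbT.
have ss := @submodule_span R {ffun T -> R^o} [set` s1 ++ s0].
exists (s1 ++ s0) => [f /=|f Mf].
  by rewrite mem_cat => /orP[/s1M//|/s0M[]].
have [g [Mg sg gf]] : [set c | exists g, [/\ M g, span [set` s1 ++ s0] g & g t = c]] (f t).
  have : ideal_gen [set` l] (f t) by rewrite -Il; exists f.
  apply: (@span_min R R^o).
    apply/submoduleP; split.
      by exists 0; split; [exact: submodule0|exact (submodule0 ss)|rewrite ffunE].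
    move=> a _ _ [g [Mg sg <-]] [h [Mh sh <-]]; exists (a *: g + h).
    by split; [exact: submoduleL|exact (submoduleL a ss sg sh)|rewrite !ffunE].
  move=> a /ls1[g gs ga]; exists g; split=> //; first exact: s1M.
  by apply: mem_span; rewrite /= mem_cat gs.
rewrite -(subrK g f); apply: (submoduleD ss) => //.
have : span [set` s0] (f - g).
  apply: Ms0; split; first exact: submoduleB.
  by rewrite !ffunE gf subrr.
by apply: span_min => // h hs; apply: mem_span; rewrite /= mem_cat; apply/orP; right.
Qed.

End Noetherian.

Section Local.
Variables (R : comPzRingType) (m : set R).
Hypothesis locR : local_ring m.

Let noethR : noetherian R. Proof. by case: locR. Qed.

Lemma local_ideal : ideal m. Proof. by case: locR => _ []. Qed.
Let im := local_ideal.

Lemma local_unit u : ~ m u -> exists v, v * u = 1.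
Proof.
move=> nmu; apply: contrapT => nu.
pose J : set R := [set v * u | v in setT].
have iJ : ideal J by exact: ideal_principal.
have [|M mM JM] := ex_maximal_ideal noethR iJ.
  by case=> v _ vu; apply: nu; exists v.
case: locR => _ _ /(_ M mM) eM; apply: nmu; rewrite -eM; apply: JM.
by exists 1; rewrite ?mul1r.
Qed.

(** Generators of [N] modulo [B] are removed one at a time: from $N\subseteq xN+B$ the first
    generator $a$ satisfies $(1-xr)a\in\langle s\rangle+B$ for some $r$, and $1-xr$ is a unit. *)
Lemma nakayama (V : lmodType R) (x : R) (N B : set V) (s : seq V) :
    m x -> submodule N -> submodule B ->
    [set` s] `<=` N -> N `<=` smod_add (span [set` s]) B ->
    (forall u, N u -> exists2 v, N v & B (u - x *: v)) ->
  N `<=` B.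
Proof.
move=> mx sN sB; elim: s => [|a s IH] sN' Ns NxN.
  by move=> u /Ns[w /span_nil-> [b Bb <-]]; rewrite add0r.
have sS := @submodule_span R V [set` s].
have Na : N a by apply: sN'; rewrite /= mem_head.
have aS : smod_add (span [set` s]) B a.
  have [v Nv Bav] := NxN a Na.
  have [_ /span_cons[r [w [sw ->]]] [b Bb vE]] := Ns v Nv.
  have [|t tu] := @local_unit (1 - x * r).
    move=> h; case: locR => _ [_ m1 _] _; apply: m1.
    rewrite -(subrK (x * r) 1); apply: (@submoduleD R R^o) => //.
    by rewrite mulrC; apply: idealM.
  exists (t *: (x *: w)); first exact (submoduleZ t sS (submoduleZ x sS sw)).
  exists (t *: ((a - x *: v) + x *: b)).
    by apply: submoduleZ => //; apply: submoduleD => //; apply: submoduleZ.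
  have E : x *: w + ((a - x *: v) + x *: b) = (1 - x * r) *: a.
    rewrite -vE scalerBl scale1r !scalerDr scalerA !opprD !addrA addrNK.
    by rewrite (addrC (x *: w) a) (addrAC a) addrK.
  by rewrite -scalerDr E scalerA tu scale1r.
apply: IH => // [u su|u /Ns[_ /span_cons[r [w [sw ->]]] [b Bb <-]]].
  by apply: sN'; rewrite /= inE; apply/orP; right.
have sSB := submodule_add sS sB.
apply: submoduleD => //; last exact: smod_addr.
by apply: submoduleL => //; apply: smod_addl.
Qed.

(** The quotient is simple or zero: a submodule strictly above [L] contains some $l+rb$ outside [L],
    so $r\notin\mathfrak m$ is a unit and $b$ itself belongs to it. *)
Lemma flen_simple (L : set R) (b : R) : ideal L -> (forall a, m a -> L (a * b)) ->
  flen (L : set R^o) (smod_add (L : set R^o) [set a * b | a in setT]).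
Proof.
move=> iL mbL; set M : set R^o := smod_add _ _.
have sb := @ideal_principal R b.
have sM : submodule M by exact: submodule_add.
apply: (@flen_bounded _ _ _ _ 1) => //; first exact: smod_addl.
case=> [|[|k]] // /chainS[K [/chainS[K' [/chain_sub[LK' _ _] KK' sK]] KM _]].
case: KM => KM []; have [K'K nKK'] := KK'.
suff Kb : K b.
  by apply: smod_add_min => // [u /LK' /K'K//|_ [a _ <-]]; apply: submoduleZ.
have [u Ku nLu] : exists2 u, K u & ~ L u.
  by apply: contrapT => h; apply: nKK' => u Ku; apply: LK';
    apply: contrapT => nL; apply: h; exists u.
have [l Ll [_ [r _ <-] lu]] := KM u Ku.
have [|t tr] := @local_unit r.
  move=> mr; apply: nLu; rewrite -lu; apply: submoduleD => //; exact: mbL.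
have -> : b = t *: (u - l : R^o).
  by rewrite -lu addrC addKr; rewrite -[RHS]/(t * (r * b)) mulrA tr mul1r.
by apply: submoduleZ => //; apply: submoduleB => //; apply/K'K/LK'.
Qed.

(** For each generator $a$ of $\mathfrak m$ in turn, the current element $b$ is replaced by $a^kb$
    with $k$ largest such that $a^kb\notin L$. *)
Lemma ex_socle (L : set R) : ideal L -> ~ L 1 ->
    (forall a, m a -> exists k, L (a ^+ k)) ->
  exists2 b, ~ L b & forall a, m a -> L (a * b).
Proof.
move=> iL L1 nilm; have [s ms] := noethR im.
have [b nLb sb] : exists2 b, ~ L b & forall a, a \in s -> L (a * b).
  have : forall a, a \in s -> exists k, L (a ^+ k).
    by move=> a sa; apply: nilm; rewrite ms; exact: sub_ideal_gen.
  elim: s {ms} => [|a s IH] nils; first by exists 1.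
  have [b sb|b nLb sb] := IH; first by apply: nils; rewrite inE sb orbT.
  have [|k0 Lk0] := nils a; first exact: mem_head.
  have ex : exists k, `[< L (a ^+ k * b) >].
    by exists k0; apply/asboolP; rewrite mulrC; apply: idealM.
  case: (ex_minnP ex) => -[|k] /asboolP Lk mk; first by rewrite mul1r in Lk.
  exists (a ^+ k * b) => [/asboolP/mk|c]; first by rewrite ltnn.
  rewrite inE => /predU1P[->|sc]; first by rewrite mulrA -exprS.
  by rewrite mulrCA; apply: idealM => //; apply: sb.
exists b => // a; rewrite ms; apply: (@span_min R R^o _ [set a | L (a * b)]) => //.
apply/submoduleP; split; first by rewrite /= mul0r; apply: (submodule0 iL).
move=> c u v Lu Lv; rewrite /= mulrDl -[_ *: _]/(c * u) -mulrA.
exact: (@submoduleL R R^o).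
Qed.

(** Noetherian induction: adjoining a socle element enlarges [L] at the cost of finite length. *)
Lemma flen_colength (L : set R) : ideal L ->
  (forall a, m a -> exists k, L (a ^+ k)) -> flen (L : set R^o) setT.
Proof.
move: L; apply: (noetherian_ind noethR (P := fun L =>
  (forall a, m a -> exists k, L (a ^+ k)) -> flen (L : set R^o) setT)) => L iL IH nilm.
have [L1|L1] := pselect (L 1).
  have -> : L = setT.
    by apply/seteqP; split=> // a _; rewrite -[a]mulr1; apply: idealM.
  by exists 0%N; apply: has_lenxx; apply: submodule_setT.
have [b nLb mb] := ex_socle iL L1 nilm.
apply: flen_trans (flen_simple iL mb) _.
have sb := @ideal_principal R b.
apply: IH; first exact: submodule_add.
  split; first exact (@smod_addl R R^o L _ sb).
  move=> h; apply: nLb; apply: h; apply: (@smod_addr R R^o L _ iL).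
  by exists 1; rewrite ?mul1r.
by move=> a /nilm[k Lk]; exists k; exact (@smod_addl R R^o L _ sb _ Lk).
Qed.

End Local.

(** [D s] consists of the vectors whose coordinates outside [s] lie in [L]; evaluation at $t$
    identifies each successive quotient with $R/L$. *)
Lemma has_len_ffun (R : comPzRingType) (T : finType) (L : set R) k :
    ideal L -> has_len (L : set R^o) setT k ->
  has_len [set f : {ffun T -> R^o} | forall t, L (f t)] setT (#|T| * k).
Proof.
move=> iL hL.
pose D (s : seq T) := [set f : {ffun T -> R^o} | forall t, t \notin s -> L (f t)].
have sD s : submodule (D s).
  apply/submoduleP; split.
    by move=> t _; rewrite ffunE; apply: (submodule0 iL).
  move=> a f g Df Dg t ts; rewrite !ffunE.
  by apply: (@submoduleL R R^o); [|apply: Df|apply: Dg].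
have H s : uniq s -> has_len (D [::]) (D s) (size s * k).
  elim: s => [|t s IH] /=; first by move=> _; apply: has_lenxx.
  case/andP => ts /IH h; rewrite mulSn addnC; apply: has_len_add h _.
  pose ev (f : {ffun T -> R^o}) : R^o := f t.
  have evl : linear ev by move=> a f g; rewrite /ev !ffunE.
  pose evL : {linear {ffun T -> R^o} -> R^o} := HB.pack ev (GRing.isLinear.Build _ _ _ _ ev evl).
  apply/(has_len_iso (f := evL) (N' := L : set R^o) (M' := setT)) => //.
    apply/seteqP; split=> // a _; apply: smod_addl => //.
    exists [ffun u => if u == t then a else 0] => [u|]; last by rewrite /= /ev ffunE eqxx.
    rewrite inE negb_or ffunE => /andP[/negPf-> _]; exact: (submodule0 iL).
  apply/seteqP; split=> f.
    move=> Df; split; last exact: Df.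
    by move=> u; rewrite inE negb_or => /andP[_]; apply: Df.
  move=> [Df Lf] u us; have [->|ut] := eqVneq u t; first exact: Lf.
  by apply: Df; rewrite inE negb_or ut.
have := H (enum T) (enum_uniq T); rewrite -cardE.
have -> : D [::] = [set f : {ffun T -> R^o} | forall t, L (f t)].
  by apply/seteqP; split=> f Df t //; apply: Df.
suff -> : D (enum T) = setT by [].
by apply/seteqP; split=> // f _ t; rewrite mem_enum.
Qed.

(** * Koszul complexes *)

Section Koszul.
Variables (R : comPzRingType) (d : nat) (x : 'I_d -> R).

(** The exterior algebra of R^d: [f B] is the coordinate of [f] along e_B. *)
Local Notation ext := {ffun {set 'I_d} -> R^o}.
Implicit Types (f g : ext) (B : {set 'I_d}) (j k : 'I_d) (p i : nat).

Definition ksign j B : R := (-1) ^+ #|[set k in B | (k < j)%N]%SET|.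

(** Interior product with the $j$-th dual basis vector. Its transpose [wedge] is left exterior
    multiplication by $e_j$. *)
Definition contract j f : ext :=
  [ffun B : {set 'I_d} => if j \in B then 0 else ksign j B * f (j |: B)%SET].

Definition wedge j f : ext :=
  [ffun B : {set 'I_d} => if j \in B then ksign j (B :\ j)%SET * f (B :\ j)%SET else 0].

Fact contract_linear j : linear (contract j).
Proof.
move=> a f g; apply/ffunP => B; rewrite !ffunE.
case: ifP => _; first by rewrite scaler0 addr0.
by rewrite mulrDr -[_ *: f _]/(a * f _) mulrCA.
Qed.
HB.instance Definition _ j := GRing.isLinear.Build _ _ _ _ _ (contract_linear j).

Fact wedge_linear j : linear (wedge j).
Proof.
move=> a f g; apply/ffunP => B; rewrite !ffunE.
case: ifP => _; last by rewrite scaler0 addr0.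
by rewrite mulrDr -[_ *: f _]/(a * f _) mulrCA.
Qed.
HB.instance Definition _ j := GRing.isLinear.Build _ _ _ _ _ (wedge_linear j).

Definition kdiff p f : ext := \sum_(k : 'I_d | (k < p)%N) x k *: contract k f.

Fact kdiff_linear p : linear (kdiff p).
Proof.
move=> a f g; rewrite /kdiff scaler_sumr -big_split; apply: eq_bigr => k _ /=.
by rewrite linearP scalerDr !scalerA mulrC.
Qed.
HB.instance Definition _ p := GRing.isLinear.Build _ _ _ _ _ (kdiff_linear p).

Lemma ksignU j k B : j \notin B ->
  ksign k (j |: B) = (if (j < k)%N then -1 else 1) * ksign k B.
Proof.
move=> jB; rewrite /ksign; case: ifP => jk.
  rewrite -exprS; congr (_ ^+ _).
  have -> : [set l in j |: B | (l < k)%N]%SET = (j |: [set l in B | (l < k)%N])%SET.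
    by apply/setP => l; rewrite !inE; case: eqP => // ->; rewrite jk.
  by rewrite cardsU1 inE (negPf jB).
rewrite mul1r; congr (_ ^+ #|pred_of_set _|); apply/setP => l; rewrite !inE.
by case: eqP => // ->; rewrite jk !andbF.
Qed.

Lemma ksign_sqr j B : ksign j B * ksign j B = 1.
Proof. by rewrite -expr2 /ksign -exprM mulnC exprM sqrrN expr1n expr1n. Qed.

Lemma ksign_swap j k B : j != k -> j \notin B -> k \notin B ->
  ksign j B * ksign k (j |: B) = - (ksign k B * ksign j (k |: B)).
Proof.
move=> jk jB kB; rewrite !ksignU //.
have : (j != k :> nat) by [].
case: (ltngtP j k) => // _ _; first by rewrite mul1r mulN1r mulrN mulrC.
by rewrite mul1r mulN1r mulrN opprK mulrC.
Qed.

Lemma contract_contract j f : contract j (contract j f) = 0.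
Proof.
apply/ffunP => B; rewrite !ffunE; case: ifP => // _.
by rewrite setU11 mulr0.
Qed.

Lemma contractC j k f : j != k ->
  contract j (contract k f) = - contract k (contract j f).
Proof.
move=> jk; apply/ffunP => B; rewrite !ffunE !inE (negPf jk) eq_sym (negPf jk) /=.
have [jB|jB] := boolP (j \in B); have [kB|kB] := boolP (k \in B);
  rewrite ?mulr0 ?oppr0 //.
by rewrite !mulrA ksign_swap // mulNr finset.setUCA.
Qed.

Lemma contract_wedgeE j f B :
  contract j (wedge j f) B = if j \in B then 0 else f B.
Proof.
rewrite !ffunE setU11; case: ifP => // jB.
by rewrite finset.setU1K ?jB // mulrA ksign_sqr mul1r.
Qed.

Lemma contract_wedge j f : contract j (wedge j f) + wedge j (contract j f) = f.
Proof.
apply/ffunP => B; rewrite ffunE contract_wedgeE !ffunE.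
case: ifP => jB; last by rewrite addr0.
by rewrite setD11 finset.setD1K // add0r mulrA ksign_sqr mul1r.
Qed.

Lemma contract_wedgeC j k f : j != k ->
  contract j (wedge k f) = - wedge k (contract j f).
Proof.
move=> jk; apply/ffunP => B; rewrite !ffunE !inE (negPf jk) eq_sym (negPf jk) /=.
have [jB|jB] := boolP (j \in B); have [kB|kB] := boolP (k \in B);
  rewrite ?mulr0 ?oppr0 //.
have jBk : j \notin (B :\ k)%SET by rewrite !inE negb_and jB orbT.
have kBk : k \notin (B :\ k)%SET by rewrite setD11.
have <- : (j |: B :\ k = (j |: B) :\ k)%SET.
  by apply/setP => l; rewrite !inE; have [->|] := eqVneq l j; rewrite ?jk ?orbT.
rewrite !mulrA -mulNr; congr (_ * _).
rewrite -{1}(finset.setD1K kB) !ksignU //.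
have : (j != k :> nat) by [].
by case: (ltngtP j k) => // _ _; rewrite !(mul1r, mulN1r, mulNr, mulrN) mulrC.
Qed.

Lemma kdiff0 f : kdiff 0 f = 0.
Proof. by rewrite /kdiff big_pred0. Qed.

Lemma kdiffS j f : kdiff j.+1 f = kdiff j f + x j *: contract j f.
Proof.
rewrite /kdiff (bigD1 j) //= addrC; congr (_ + _); apply: eq_bigl => k.
by rewrite ltnS ltn_neqAle andbC.
Qed.

Lemma kdiff_contract p j f : kdiff p (contract j f) = - contract j (kdiff p f).
Proof.
rewrite /kdiff linear_sum -sumrN; apply: eq_bigr => k _; rewrite linearZ /=.
have [->|kj] := eqVneq k j; first by rewrite !contract_contract scaler0 oppr0.
by rewrite contractC // scalerN.
Qed.

Lemma kdiff_wedge_lt p j f : (p <= j)%N -> kdiff p (wedge j f) = - wedge j (kdiff p f).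
Proof.
move=> pj; rewrite /kdiff linear_sum -sumrN; apply: eq_bigr => k kp.
rewrite linearZ /= contract_wedgeC ?scalerN //.
by apply: contraTneq kp => ->; rewrite -leqNgt.
Qed.

(** Exterior multiplication by $e_j$ is a homotopy between multiplication by $x_j$ and zero, by the
    anticommutation relations of contractions and wedges. *)
Lemma kdiff_wedge p j f : (j < p)%N ->
  kdiff p (wedge j f) + wedge j (kdiff p f) = x j *: f.
Proof.
move=> jp; rewrite /kdiff linear_sum -big_split (bigD1 j) //= big1 => [|k /andP[_ kj]].
  by rewrite linearZ -scalerDr /= contract_wedge addr0.
by rewrite linearZ /= contract_wedgeC // scalerN addNr.
Qed.

Lemma kdiff_kdiff p f : (p <= d)%N -> kdiff p (kdiff p f) = 0.
Proof.
elim: p f => [|p IH] f pd; first by rewrite kdiff0.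
rewrite !(kdiffS (Ordinal pd)) /= linearD linearZ /= kdiff_contract IH 1?ltnW // add0r.
rewrite linearD linearZ /= contract_contract scaler0 addr0 scalerN.
by rewrite addNr.
Qed.

Lemma ext_split j f : f = contract j (wedge j f) + wedge j (contract j f).
Proof. by rewrite contract_wedge. Qed.

(** The complex on $x_0,\dots,x_j$ as the mapping cone of $x_j$ on the complex on
    $x_0,\dots,x_{j-1}$: for $f=f'+e_j\wedge g$ with $f',g$ free of $e_j$, the differential is
    $(\partial f'+x_jg)-e_j\wedge\partial g$. *)
Lemma kdiff_cone j f : kdiff j.+1 f =
  (kdiff j (contract j (wedge j f)) + x j *: contract j f)
    - wedge j (kdiff j (contract j f)).
Proof.
rewrite kdiffS {1}(ext_split j f) linearD /= (kdiff_wedge_lt _ (leqnn j)).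
by rewrite addrAC.
Qed.

(** Degree $i$ term of the Koszul complex on the first $p$ elements, as a support condition;
    changing $i$ or $p$ then needs no change of type. *)
Definition hom_ext i p : set ext :=
  [set f | forall B, ~~ ((#|B| == i) && (B \subset [set k : 'I_d | (k < p)%N]%SET)) -> f B = 0].

Lemma hom_extP i p f : hom_ext i p f <->
  forall B, f B != 0 -> #|B| = i /\ forall k, k \in B -> (k < p)%N.
Proof.
split=> h B; last first.
  apply: contraNeq => /h[Bi Bp]; rewrite Bi eqxx; apply/fintype.subsetP => k /Bp.
  by rewrite inE.
move=> fB; have : ~~ ~~ ((#|B| == i) && (B \subset [set k : 'I_d | (k < p)%N]%SET)).
  by apply: contra fB => /h ->.
rewrite negbK => /andP[/eqP-> /fintype.subsetP s]; split=> // k /s.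
by rewrite inE.
Qed.

Lemma submodule_hom_ext i p : submodule (hom_ext i p).
Proof.
apply/submoduleP; split=> [B|a f g hf hg B aB]; rewrite !ffunE //.
by rewrite hf // hg // scaler0 addr0.
Qed.

Lemma hom_extS i p q f : (p <= q)%N -> hom_ext i p f -> hom_ext i q f.
Proof.
move=> pq /hom_extP hf; apply/hom_extP => B /hf[-> s]; split=> // k /s kp.
exact: leq_trans kp pq.
Qed.

Lemma hom_contract i p j f : hom_ext i.+1 p f -> hom_ext i p (contract j f).
Proof.
move/hom_extP => hf; apply/hom_extP => B; rewrite ffunE.
case: ifPn => [|jB h]; first by rewrite eqxx.
have /hf[] : f (j |: B)%SET != 0 by apply: contraNneq h => ->; rewrite mulr0.
rewrite cardsU1 jB => -[<-] s; split=> // k kB; apply: s.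
by rewrite inE kB orbT.
Qed.

Lemma hom_contract_last i j f : hom_ext i.+1 j.+1 f -> hom_ext i j (contract j f).
Proof.
move=> hf; have /hom_extP hc := hom_contract j hf.
apply/hom_extP => B cB; have [Bi s] := hc B cB; split=> // k kB.
rewrite ltn_neqAle -ltnS s // andbT; apply: contraNneq cB => /val_inj kj.
by rewrite ffunE -kj kB.
Qed.

Lemma hom_wedge i p j f : (j < p)%N -> hom_ext i p f -> hom_ext i.+1 p (wedge j f).
Proof.
move=> jp /hom_extP hf; apply/hom_extP => B; rewrite ffunE.
case: ifPn => [jB h|]; last by rewrite eqxx.
have /hf[c s] : f (B :\ j)%SET != 0 by apply: contraNneq h => ->; rewrite mulr0.
rewrite (cardsD1 j) jB c; split=> // k kB; have [->//|kj] := eqVneq k j.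
by apply: s; rewrite !inE kj.
Qed.

Lemma hom_contract_wedge i j f : hom_ext i j.+1 f -> hom_ext i j (contract j (wedge j f)).
Proof.
move/hom_extP => hf; apply/hom_extP => B; rewrite contract_wedgeE.
case: ifPn => [|jB /hf[Bi s]]; first by rewrite eqxx.
split=> // k kB; rewrite ltn_neqAle -ltnS s // andbT.
by apply: contraNneq jB => /val_inj <-.
Qed.

Lemma contract_hom i p j f : (p <= j)%N -> hom_ext i p f -> contract j f = 0.
Proof.
move=> pj /hom_extP hf; apply/ffunP => B; rewrite !ffunE; case: ifP => // _.
have [->|/hf[_ s]] := eqVneq (f (j |: B)%SET) 0; first by rewrite mulr0.
by have := s j (setU11 _ _); rewrite ltnNge pj.
Qed.

Lemma hom_kdiff i p f : hom_ext i.+1 p f -> hom_ext i p (kdiff p f).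
Proof.
move=> hf; apply: submodule_sum => [|k _]; first exact: submodule_hom_ext.
exact (submoduleZ (x k) (submodule_hom_ext i p) (hom_contract k hf)).
Qed.

Lemma hom_gt i p f : (d < i)%N -> hom_ext i p f -> f = 0.
Proof.
move=> di hf; apply/ffunP => B; rewrite ffunE hf // negb_and neq_ltn.
by rewrite (leq_ltn_trans _ di) // -[leqRHS]card_ord max_card.
Qed.

Lemma hom_p0 i f : hom_ext i.+1 0 f -> f = 0.
Proof.
move=> /hom_extP hf; apply/ffunP => B; rewrite ffunE; apply/eqP.
apply/contraT => /hf[Bi s]; have : (0 < #|B|)%N by rewrite Bi.
by case/card_gt0P => k /s.
Qed.

Lemma hom0E p f B : hom_ext 0 p f -> B != finset.set0 -> f B = 0.
Proof. by move=> hf B0; apply: hf; rewrite cards_eq0 (negPf B0). Qed.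

Definition ext_in (J : set R) : set ext := [set f | forall B, J (f B)].

Lemma submodule_ext_in J : ideal J -> submodule (ext_in J).
Proof.
move=> iJ; apply/submoduleP; split=> [B|a f g Jf Jg B]; rewrite !ffunE.
  exact: (submodule0 iJ).
exact: (@submoduleL R R^o).
Qed.

(** The lift is chosen coordinatewise, with 0 off the support so that homogeneity survives. *)
Lemma hom_lift i p (J J' : set R) (f : ext) (y : R) :
    ideal J -> ideal J' -> (forall a, J' a -> exists b, J (a - y * b)) ->
    hom_ext i p f -> ext_in J' f ->
  exists2 g, hom_ext i p g & ext_in J (f - y *: g).
Proof.
move=> iJ iJ' JJ' hf Jf.
have h B : exists b : R, J (f B - y * b) /\
    (~~ ((#|B| == i) && (B \subset [set k : 'I_d | (k < p)%N]%SET)) -> b = 0).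
  have [fB|aB] := boolP ((#|B| == i) && (B \subset [set k : 'I_d | (k < p)%N]%SET)).
    by have [b Jb] := JJ' _ (Jf B); exists b.
  exists 0; split=> //; rewrite hf // mulr0 subr0; exact: (submodule0 iJ).
exists [ffun B => projT1 (cid (h B))] => B; rewrite !ffunE; by case: cid => b [].
Qed.

Lemma kdiff_ext_in p J f : ideal J -> ext_in J f -> ext_in J (kdiff p f).
Proof.
move=> iJ Jf; apply: submodule_sum => [|k _]; first exact: submodule_ext_in.
apply (submoduleZ (x k) (submodule_ext_in iJ)).
move=> B; rewrite ffunE; case: ifP => _; first exact: (submodule0 iJ).
exact: idealM.
Qed.

(** The Koszul complex on x_1, ..., x_p with coefficients in R / J is exact in
    all degrees > c. *)
Definition koszul_exact p c (J : set R) := forall i f, (c <= i)%N ->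
  hom_ext i.+1 p f -> ext_in J (kdiff p f) ->
  exists2 g, hom_ext i.+2 p g & ext_in J (f - kdiff p g).

(** The $y$ that kill the class of [f] form an ideal, and it contains each $x_k$ by the homotopy
    [wedge k]. *)
Lemma koszul_annihilated (J : set R) y i f : ideal J ->
    ideal_gen [set x k | k in setT] y -> hom_ext i d f -> ext_in J (kdiff d f) ->
  exists2 g, hom_ext i.+1 d g & ext_in J (y *: f - kdiff d g).
Proof.
move=> iJ Xy hf Jf.
have sJ := submodule_ext_in iJ; have sh := submodule_hom_ext i.+1 d.
pose Y := [set y : R | exists2 g, hom_ext i.+1 d g & ext_in J (y *: f - kdiff d g)].
apply: (@ideal_gen_min _ _ Y) Xy.
  apply/submoduleP; split.
    exists 0; first exact (submodule0 sh).
    by rewrite scale0r linear0 subr0; exact (submodule0 sJ).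
  move=> a u v [g hg ug] [g' hg' ug']; exists (a *: g + g'); first exact (submoduleL a sh hg hg').
  rewrite scalerDl -scalerA linearP opprD addrACA -scalerBr.
  exact (submoduleL a sJ ug ug').
move=> _ [k _ <-]; exists (wedge k f); first exact (hom_wedge (ltn_ord k) hf).
rewrite -(kdiff_wedge (p := d)) // addrC addKr => B; rewrite ffunE.
case: ifP => _; last exact: (submodule0 iJ).
exact: idealM.
Qed.

(** Depth sensitivity: a nonzerodivisor y mod J with a power in (x) lowers the
    vanishing range of Koszul homology by one when passing from J + (y) to J. *)
Lemma koszul_exact_regular (J J' : set R) y N c : ideal J -> ideal J' ->
    J `<=` J' -> J' y ->
    (forall a, J' a -> exists b, J (a - y * b)) ->
    (forall a, J (y * a) -> J a) ->
    ideal_gen [set x k | k in setT] (y ^+ N) ->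
  koszul_exact d c.+1 J' -> koszul_exact d c J.
Proof.
move=> iJ iJ' JJ' J'y J'E regy XyN ex i f ci hf Jf.
have sJ := submodule_ext_in iJ.
(* If $yg\equiv\partial h$ modulo $J$, then $h$ is a cycle modulo $J'$, one degree higher, so
   $h\equiv\partial u+yw$ modulo $J$. Hence $y(g-\partial w)\in J$, and $y$ cancels. *)
have step g : hom_ext i.+1 d g -> ext_in J (kdiff d g) ->
    (exists2 h, hom_ext i.+2 d h & ext_in J (y *: g - kdiff d h)) ->
  exists2 h, hom_ext i.+2 d h & ext_in J (g - kdiff d h).
  move=> hg Jg [h hh Jh].
  have [u hu Ju] : exists2 u, hom_ext i.+3 d u & ext_in J' (h - kdiff d u).
    apply: ex => // B; rewrite -(subrK ((y *: g) B) (kdiff d h B)).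
    apply: (@submoduleD R R^o) => //.
      by apply: JJ'; have := submoduleN sJ Jh B; rewrite !ffunE opprB.
    by rewrite ffunE -[_ *: _]/(y * g B) mulrC; apply: idealM.
  have [w hw Jw] := hom_lift iJ iJ' J'E
    (submoduleB (submodule_hom_ext _ _) hh (hom_kdiff hu)) Ju.
  exists w => // B; apply: regy.
  suff : ext_in J (y *: (g - kdiff d w)) by move=> /(_ B); rewrite ffunE.
  have := submoduleD sJ Jh (kdiff_ext_in d iJ Jw).
  by rewrite !linearB /= kdiff_kdiff // subr0 linearZ /= addrA addrNK -scalerBr.
(* Starting from $y^N$, which kills the homology, [step] removes one factor $y$ at a time; for $n>N$
   the truncated exponent stays 0. *)
have key n : exists2 h, hom_ext i.+2 d h & ext_in J (y ^+ (N - n) *: f - kdiff d h).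
  elim: n => [|n IH]; first by rewrite subn0; exact (koszul_annihilated iJ XyN hf Jf).
  have [lt|ge] := ltnP n N; last by move: IH; rewrite (eqP ge) (eqP (leqW ge)).
  apply: step.
  - exact (submoduleZ _ (submodule_hom_ext _ _) hf).
  - rewrite linearZ; exact (submoduleZ _ sJ Jf).
  - by move: IH; rewrite scalerA -exprS subnSK.
by have := key N; rewrite subnn scale1r.
Qed.

End Koszul.
Arguments submodule_hom_ext {R d} i p.
Arguments submodule_ext_in {R d J}.

Lemma qring_pi_eq (R : comPzRingType) (J : set R) a b : ideal J ->
  qring_pi J a = qring_pi J b <-> J (a - b).
Proof.
move=> iJ; rewrite (rwP eqP) /qring_pi eq_pi_qmod inE (@span_id R R^o) //.
Qed.

Lemma qring_pi_mul (R : comPzRingType) (J : set R) a b :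
  qring_pi J (a * b) = qring_pi J a * qring_pi J b.
Proof. exact: qring_piM. Qed.

Lemma lreg_qring (R : comPzRingType) (J : set R) y a : ideal J ->
  GRing.lreg (qring_pi J y) -> J (y * a) -> J a.
Proof.
move=> iJ reg Jya; rewrite -[a]subr0; apply/qring_pi_eq => //; apply: reg.
rewrite -!qring_pi_mul; apply/qring_pi_eq => //.
by rewrite mulr0 subr0.
Qed.

(** * Acyclicity *)

Section Acyclic.
Variables (R : comPzRingType) (d : nat) (x : 'I_d -> R).
Local Notation ext := {ffun {set 'I_d} -> R^o}.
Implicit Types (f g u v : ext) (j k : 'I_d).

Definition ext_const (c : R) : ext := [ffun B => if B == finset.set0 then c else 0].

Lemma hom_const c p : hom_ext 0 p (ext_const c).
Proof.
apply/hom_extP => B; rewrite ffunE; have [->|] := eqVneq B finset.set0; last by rewrite eqxx.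
by rewrite cards0 => _; split=> // k; rewrite inE.
Qed.

Arguments hom_const : clear implicits.

Lemma hom0_const p f : hom_ext 0 p f -> f = ext_const (f finset.set0).
Proof.
move=> hf; apply/ffunP => B; rewrite ffunE; have [->//|B0] := eqVneq B finset.set0.
exact: hom0E hf B0.
Qed.

Lemma kdiff_const p c : kdiff x p (ext_const c) = 0.
Proof.
rewrite /kdiff big1 // => k _.
by rewrite (contract_hom (leq0n k) (hom_const c 0)) scaler0.
Qed.

Definition head_ideal (p : nat) : set R := ideal_gen [set x k | k in [set k : 'I_d | (k < p)%N]].

(** The ideal is the module of boundaries in degree zero; this translates ideal membership into
    chains. *)
Lemma head_idealP p c : (p <= d)%N -> head_ideal p c <->
  exists2 u, hom_ext 1 p u & kdiff x p u = ext_const c.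
Proof.
move=> pd; split=> [|[u hu uc]]; last first.
  have -> : c = kdiff x p u finset.set0 by rewrite uc ffunE eqxx.
  rewrite /kdiff sum_ffunE; apply: (@submodule_sum R R^o) => [|k kp].
    exact: ideal_gen_ideal.
  rewrite ffunE -[_ *: _]/(_ * _) mulrC; apply (idealM _ (@ideal_gen_ideal R _)).
  by apply: sub_ideal_gen; exists k.
pose Y : set R := [set c | exists2 u, hom_ext 1 p u & kdiff x p u = ext_const c].
have sh := @submodule_hom_ext R d 1 p.
apply: (@ideal_gen_min _ _ Y).
  apply/submoduleP; split.
    exists 0; first exact (submodule0 sh).
    by rewrite linear0; apply/ffunP => B; rewrite !ffunE if_same.
  move=> a b e [u hu ub] [v hv ve]; exists (a *: u + v).
    exact (submoduleL a sh hu hv).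
  rewrite linearP /= ub ve; apply/ffunP => B; rewrite !ffunE.
  by case: ifP => // _; rewrite scaler0 addr0.
move=> _ [k kp <-]; exists (wedge k (ext_const 1)).
  exact (hom_wedge kp (hom_const 1 p)).
have := kdiff_wedge x (ext_const 1) kp.
rewrite kdiff_const linear0 addr0 => ->; apply/ffunP => B; rewrite !ffunE.
by case: ifP => _; [rewrite -[_ *: _]/(_ * _) mulr1|rewrite scaler0].
Qed.

Definition koszul_acyclic p := forall i f, hom_ext i.+1 p f -> kdiff x p f = 0 ->
  exists2 g, hom_ext i.+2 p g & f = kdiff x p g.

(** If $x_jc=\partial u$ over the earlier elements, then $u-c\,e_j$ is a cycle over $x_0,\dots,x_j$,
    hence some $\partial G$. Contracting with $j$ gives $c=\partial(\iota_jG)$, where $\iota_j$ is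
    [contract j]. *)
Lemma acyclic_regular j c : koszul_acyclic j.+1 ->
  head_ideal j (x j * c) -> head_ideal j c.
Proof.
move=> ac; have jd := ltnW (ltn_ord j).
move=> /(head_idealP _ jd)[u hu ku].
have hc : hom_ext 1 j.+1 (u - wedge j (ext_const c)).
  apply (submoduleB (submodule_hom_ext _ _)); first exact (hom_extS (leqnSn j) hu).
  exact (hom_wedge (ltnSn j) (hom_const c _)).
have k0 : kdiff x j.+1 (u - wedge j (ext_const c)) = 0.
  rewrite linearB /=; have := kdiff_wedge x (ext_const c) (ltnSn j).
  rewrite kdiff_const linear0 addr0 => ->.
  rewrite kdiffS (contract_hom (leqnn j) hu) scaler0 addr0 ku.
  apply/ffunP => B; rewrite !ffunE.
  by case: ifP => _; rewrite ?scaler0 ?subr0 // -[_ *: _]/(_ * _) subrr.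
have [G hG eG] := ac _ _ hc k0.
apply/(head_idealP _ jd); exists (contract j G).
  exact (hom_contract_last hG).
have := congr1 (contract j) eG; rewrite linearB /= (contract_hom (leqnn j) hu) sub0r.
rewrite kdiffS linearD linearZ /= contract_contract scaler0 addr0.
rewrite -[contract j (kdiff _ _ _)]opprK -kdiff_contract => /oppr_inj <-.
by rewrite -[RHS](contract_wedge j) (contract_hom (leq0n j) (hom_const c 0)) linear0 addr0.
Qed.

(** The mapping cone of multiplication by x_j gives H_i = x_j H_i for the
    Koszul complex of the previous elements, and Nakayama applies. *)
Lemma koszul_acyclic_head (m : set R) j : local_ring m -> m (x j) ->
  koszul_acyclic j.+1 -> koszul_acyclic j.
Proof.
move=> locR mx ac i f hf kf.
have sh n p := @submodule_hom_ext R d n p.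
pose N : set ext := hom_ext i.+1 j `&` [set f | kdiff x j f = 0].
pose B : set ext := kdiff x j @` hom_ext i.+2 j.
have sN : submodule N.
  apply: submodule_setI; first exact: sh.
  apply/submoduleP; split=> [|a u v /= ku kv]; first by rewrite /= linear0.
  by rewrite linearP /= ku kv scaler0 addr0.
have sB : submodule B by apply: submodule_image; exact: sh.
have [noeR _ _] := locR.
have [s sN' Ns] := ffun_fg noeR sN.
suff : N `<=` B by move=> /(_ f (conj hf kf))[g hg <-]; exists g.
apply: (nakayama locR mx sN sB sN') => [u Nu|].
  by apply: smod_addl => //; exact: Ns.
move=> u [hu ku].
have k0 : kdiff x j.+1 u = 0.
  by rewrite kdiffS ku (contract_hom (leqnn j) hu) scaler0 addr0.
(* With $G=G'+e_j\wedge g$, comparing the parts with and without $e_j$ gives $\partial g=0$ and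
   $u=\partial G'+x_jg$, so $g$ is the element required by Nakayama. *)
have [G hG eG] := ac _ _ (hom_extS (leqnSn j) hu) k0.
have /eqP := contract_hom (leqnn j) hu; rewrite {1}eG kdiffS linearD linearZ /=.
rewrite contract_contract scaler0 addr0 => /eqP kG'.
have kG : kdiff x j (contract j G) = 0 by rewrite kdiff_contract kG' oppr0.
exists (contract j G).
  by split; [exact (hom_contract_last hG)|exact: kG].
exists (contract j (wedge j G)); first exact (hom_contract_wedge hG).
rewrite [in RHS]eG kdiff_cone kG linear0 subr0.
by rewrite addrK.
Qed.

Lemma koszul_acyclic_all (m : set R) p : local_ring m -> (forall j, m (x j)) ->
  koszul_acyclic d -> (p <= d)%N -> koszul_acyclic p.
Proof.
move=> locR mx ac; move/subKn <-; elim: (d - p)%N => [|k IH]; first by rewrite subn0.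
have [kd|kd] := ltnP k d; last by move: IH; rewrite (eqP kd) (eqP (leqW kd)).
have lt : (d - k.+1 < d)%N by rewrite -subn_gt0 subKn.
apply: (@koszul_acyclic_head m (Ordinal lt)) => //=.
by rewrite subnSK.
Qed.

(** Descending induction along the regular sequence: modulo all $d$ elements, exactness in degrees
    above $d$ is trivial, and each element removed from the ideal gains one degree, down to
    exactness in all positive degrees over $R$. *)
Lemma regular_koszul_acyclic (m : set R) (s : seq R) :
    regular_seq s -> size s = d -> [set` s] `<=` m ->
    (forall y, m y -> exists N, ideal_gen [set x k | k in setT] (y ^+ N)) ->
  koszul_acyclic d.
Proof.
move=> [reg _] sd sm nil.
pose J (k : nat) := ideal_gen [set` take k s].
have iJ (k : nat) : ideal (J k) by exact: ideal_gen_ideal.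
have H (k : nat) : (k <= d)%N -> koszul_exact x d k (J k).
  move/subKn <-; elim: (d - k)%N => [|l IH].
    rewrite subn0 => i f di hf _; exists 0; first exact (submodule0 (submodule_hom_ext _ _)).
    have -> : f = 0 by exact (hom_gt (di : (d < i.+1)%N) hf).
    by rewrite linear0 subr0; exact (submodule0 (submodule_ext_in (iJ _))).
  have [kd|kd] := ltnP l d; last by move: IH; rewrite (eqP kd) (eqP (leqW kd)).
  rewrite -(subnSK kd) in IH; set c := (d - l.+1)%N in IH *.
  have cs : (c < size s)%N by rewrite sd /c -subn_gt0 subKn.
  have [N XN] : exists N, ideal_gen [set x k | k in setT] (s`_c ^+ N).
    by apply: nil; apply: sm; rewrite /= mem_nth.
  have tk : take c.+1 s = rcons (take c s) s`_c by rewrite -take_nth.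
  apply: (koszul_exact_regular (iJ c) (iJ c.+1) _ _ _ _ XN IH).
  - apply: ideal_gen_min => // a /= ac; apply: sub_ideal_gen.
    by rewrite /= tk mem_rcons inE ac orbT.
  - by apply: sub_ideal_gen; rewrite /= tk mem_rcons mem_head.
  - pose Y : set R := [set a | exists b, J c (a - s`_c * b)].
    apply: (@ideal_gen_min _ _ Y).
      apply/submoduleP; split; first by exists 0; rewrite mulr0 subr0; exact: (submodule0 (iJ c)).
      move=> a u v [b Jb] [e Je]; exists (a * b + e).
      rewrite mulrDr opprD addrACA mulrCA -mulrBr.
      exact (@submoduleL R R^o (J c) a _ _ (iJ c) Jb Je).
    move=> a /=; rewrite tk mem_rcons inE => /predU1P[->|ac].
      by exists 1; rewrite mulr1 subrr; exact: (submodule0 (iJ c)).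
    by exists 0; rewrite mulr0 subr0; apply: sub_ideal_gen.
  - by move=> a; apply: lreg_qring => //; apply: reg.
move=> i f hf kf.
have J0 a : J 0%N a -> a = 0 by rewrite /J take0; exact: (@span_nil R R^o).
have [B|g hg gf] := H 0%N (leq0n d) i f (leq0n i) hf.
  by rewrite kf ffunE; exact: (submodule0 (iJ _)).
exists g => //; apply/eqP; rewrite -subr_eq0; apply/eqP/ffunP => B.
by rewrite (J0 _ (gf B)) ffunE.
Qed.

(** * Koszul complexes with filtered coefficients *)

Section Filtration.
Variable L : int -> set R.
Hypothesis iL : forall n, ideal (L n).
Hypothesis xL : forall (n : int) j a, L (n - 1) a -> L n (x j * a).

(** The subcomplex with coefficients in $L(n-i)$ in degree $i$, all degrees at once; for
    $L(k)=I_1I_2^k$ the quotient by it is $C(1,n)$. *)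
Definition fil (n : int) : set ext := [set f | forall B : {set 'I_d}, L (n - #|B|%:Z) (f B)].

Lemma submodule_fil n : submodule (fil n).
Proof.
apply/submoduleP; split=> [B|a f g ff fg B]; rewrite !ffunE.
  exact: (submodule0 (iL _)).
exact (@submoduleL R R^o _ _ _ _ (iL _) (ff B) (fg B)).
Qed.

Lemma fil_wedge n j f : fil (n - 1) f -> fil n (wedge j f).
Proof.
move=> ff B; rewrite ffunE; case: ifP => jB; last exact: (submodule0 (iL _)).
apply: idealM => //; have := ff (B :\ j)%SET.
by rewrite (cardsD1 j B) jB PoszD opprD addrA.
Qed.

Lemma fil_contract n j f : fil n f -> fil (n - 1) (contract j f).
Proof.
move=> ff B; rewrite ffunE; case: ifP => jB; first exact: (submodule0 (iL _)).
apply: idealM => //; have := ff (j |: B)%SET.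
by rewrite cardsU1 jB PoszD opprD addrA.
Qed.

Lemma filZx n j f : fil (n - 1) f -> fil n (x j *: f).
Proof.
by move=> ff B; rewrite ffunE; apply: xL; have := ff B; rewrite addrAC.
Qed.

Lemma fil_kdiff n p f : fil n f -> fil n (kdiff x p f).
Proof.
move=> ff; apply: submodule_sum => [|k _]; first exact: submodule_fil.
exact (filZx _ (fil_contract k ff)).
Qed.

(** The filtration splits along $f-e_j\wedge g$; the index of $g$ drops by one because $e_j$ has
    degree one. *)
Lemma fil_cone n j f g : contract j f = 0 -> contract j g = 0 ->
  fil n (f - wedge j g) -> fil n f /\ fil (n - 1) g.
Proof.
move=> cf cg h.
have fg : fil (n - 1) g.
  have := fil_contract j h; rewrite linearB /= cf sub0r.
  have -> : contract j (wedge j g) = g.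
    by rewrite -[RHS](contract_wedge j) cg linear0 addr0.
  by move/(submoduleN (submodule_fil _)); rewrite opprK.
split=> //; rewrite -(subrK (wedge j g) f).
exact (submoduleD (submodule_fil n) h (fil_wedge j fg)).
Qed.

Definition fil_exact p n := forall i f, hom_ext i.+1 p f -> fil n (kdiff x p f) ->
  exists2 g, hom_ext i.+2 p g & fil n (f - kdiff x p g).

(** The colon hypothesis makes x_j injective on H_0 of the truncated complex,
    which is what the mapping cone needs in degree one. *)
Lemma fil_exactS j n : fil_exact j n -> fil_exact j (n - 1) ->
    (forall c, smod_add (L n : set R^o) (head_ideal j : set R^o) (x j * c) ->
       smod_add (L (n - 1) : set R^o) (head_ideal j : set R^o) c) ->
  fil_exact j.+1 n.
Proof.
move=> ex ex1 colon i f hf; have jd := ltnW (ltn_ord j).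
set f' := contract j (wedge j f); set g := contract j f.
have hf' : hom_ext i.+1 j f' by exact (hom_contract_wedge hf).
have hg : hom_ext i j g by exact (hom_contract_last hf).
have cf' : contract j f' = 0 by exact: contract_contract.
have cg : contract j g = 0 by exact: contract_contract.
rewrite kdiff_cone -/f' -/g => /fil_cone[].
- rewrite linearD linearZ /= cg scaler0 addr0.
  by apply: oppr_inj; rewrite -kdiff_contract cf' linear0 oppr0.
- by apply: oppr_inj; rewrite -kdiff_contract cg linear0 oppr0.
move=> ff' fg.
(* In positive degree $g$ is a cycle of the quotient at $n-1$, which is exact there. In degree zero
   $g$ is a constant $c$, and the component $\partial f'+x_jc\in L(n)$ feeds the colon
   hypothesis. *)
have [u hu ug] : exists2 u, hom_ext i.+1 j u & fil (n - 1) (g - kdiff x j u).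
  case: i => [|i] in f hf @f' @g hf' hg cf' cg ff' fg *; last exact: ex1.
  have := ff' finset.set0; rewrite cards0 subr0 ffunE [X in _ + X]ffunE.
  set c := g finset.set0 => Lc.
  have [l Ll [b Xb e]] :
      smod_add (L (n - 1) : set R^o) (head_ideal j : set R^o) c.
    apply: colon.
    exists (kdiff x j f' finset.set0 + x j * c); first exact: Lc.
    exists (- kdiff x j f' finset.set0); last by rewrite addrC addKr.
    apply (@submoduleN R R^o _ _ (@ideal_gen_ideal R _)).
    apply/(head_idealP _ jd); exists f' => //.
    by apply: (@hom0_const j); exact (hom_kdiff x hf').
  have [u hu uE] := (head_idealP b jd).1 Xb.
  exists u => //; rewrite uE (hom0_const hg) -/c => B; rewrite !ffunE.
  have [->|_] := eqVneq B finset.set0; last by rewrite subrr; exact: (submodule0 (iL _)).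
  by rewrite cards0 subr0 -e addrK.
have [v hv vf] : exists2 v, hom_ext i.+2 j v & fil n (f' + x j *: u - kdiff x j v).
  apply: ex; first exact (submoduleD (submodule_hom_ext _ _) hf' (submoduleZ _ (submodule_hom_ext _ _) hu)).
  have := submoduleB (submodule_fil n) ff' (filZx j ug).
  by rewrite scalerBr opprB addrACA subrr addr0 linearD linearZ.
(* The sign comes from $\partial(e_j\wedge u)=x_ju-e_j\wedge\partial u$: the difference to $f$
   becomes $(f'+x_ju-\partial v)+e_j\wedge(g-\partial u)$. *)
exists (v - wedge j u).
  apply (submoduleB (submodule_hom_ext _ _)); first exact (hom_extS (leqnSn j) hv).
  exact (hom_wedge (ltnSn j) (hom_extS (leqnSn j) hu)).
have := submoduleD (submodule_fil n) vf (fil_wedge j ug).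
suff -> : f' + x j *: u - kdiff x j v + wedge j (g - kdiff x j u) =
   f - kdiff x j.+1 (v - wedge j u) by [].
have kw := kdiff_wedge x u (ltnSn j).
have ku : kdiff x j.+1 u = kdiff x j u.
  by rewrite kdiffS (contract_hom (leqnn j) hu) scaler0 addr0.
have kv : kdiff x j.+1 v = kdiff x j v.
  by rewrite kdiffS (contract_hom (leqnn j) hv) scaler0 addr0.
rewrite ku in kw; rewrite !linearB /= kv [in RHS](ext_split j f) -/f' -/g.
have -> : x j *: u = kdiff x j.+1 (wedge j u) + wedge j (kdiff x j u) by [].
rewrite opprK -!addrA; congr (_ + _).
rewrite [- kdiff x j v + (wedge j g + _)]addrCA [X in _ + X = _]addrCA.
by rewrite [X in _ + (_ + X) = _]addrC addrNK addrCA [kdiff _ _ _ + _]addrC.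
Qed.

Lemma fil_exact0 n : fil_exact 0 n.
Proof.
move=> i f hf _; have -> : f = 0 by exact (hom_p0 hf).
exists 0; first exact (submodule0 (submodule_hom_ext _ _)).
by rewrite linear0 subr0; exact (submodule0 (submodule_fil _)).
Qed.

(** Each cone step at $n$ uses exactness at $n$ and $n-1$, so the threshold rises by one per
    element, from [n0] to [n0 + d]. *)
Lemma fil_exact_large (n0 : int) :
    (forall j (n : int) c, n0 <= n ->
       smod_add (L n : set R^o) (head_ideal j : set R^o) (x j * c) ->
       smod_add (L (n - 1) : set R^o) (head_ideal j : set R^o) c) ->
  forall n : int, n0 + d%:Z <= n -> fil_exact d n.
Proof.
move=> colon; suff H (p : nat) : (p <= d)%N -> forall n : int, n0 + p%:Z <= n -> fil_exact p n.
  exact: H.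
elim: p => [|p IH] pd n np0; first exact: fil_exact0.
have np : n0 + p%:Z <= n - 1 by rewrite lerBrDr -addrA -PoszD addn1.
have ex : fil_exact p n.
  by apply: IH; [exact: ltnW|apply: le_trans np _; rewrite gerBl].
have ex1 : fil_exact p (n - 1) by apply: IH => //; exact: ltnW.
apply (@fil_exactS (Ordinal pd) n ex ex1) => c.
apply: (colon (Ordinal pd)); apply: le_trans (le_trans np _); rewrite ?gerBl //.
by rewrite lerDl.
Qed.

End Filtration.
End Acyclic.

(** * Superficial sequences *)

Section IdealProduct.
Variable R : comPzRingType.
Implicit Types (I J K : set R) (a b : R).

Lemma ideal_mul_ideal I J : ideal (ideal_mul I J).
Proof. exact: ideal_gen_ideal. Qed.

Lemma mem_ideal_mul I J a b : I a -> J b -> ideal_mul I J (a * b).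
Proof. by move=> Ia Jb; apply: sub_ideal_gen; exists a => //; exists b. Qed.

Lemma ideal_mul_min I J K : ideal K -> (forall a b, I a -> J b -> K (a * b)) ->
  ideal_mul I J `<=` K.
Proof. by move=> iK h; apply: ideal_gen_min => // _ [a Ia [b Jb <-]]; exact: h. Qed.

Lemma ideal_mul_subl I J : ideal I -> ideal_mul I J `<=` I.
Proof. by move=> iI; apply: ideal_mul_min => // a b Ia _; rewrite mulrC; apply: idealM. Qed.

Lemma ideal_mul_subr I J : ideal J -> ideal_mul I J `<=` J.
Proof. by move=> iJ; apply: ideal_mul_min => // a b _ Jb; apply: idealM. Qed.

Lemma ideal_mulT I : ideal I -> ideal_mul I setT = I.
Proof.
move=> iI; apply/seteqP; split; first exact: ideal_mul_subl.
by move=> a Ia; rewrite -[a]mulr1; apply: mem_ideal_mul.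
Qed.

Lemma ideal_exp_ideal I n : ideal (ideal_exp I n).
Proof. by case: n => [|n]; [exact: (@submodule_setT R R^o)|exact: ideal_mul_ideal]. Qed.

Lemma ideal_exp_anti I n k : (n <= k)%N -> ideal_exp I k `<=` ideal_exp I n.
Proof.
move/subnK <-; elim: (k - n)%N => [|l IH] // a.
by move/(@ideal_mul_subr I _ (ideal_exp_ideal I (l + n)))/IH.
Qed.

Lemma ideal_exp1 I : ideal I -> ideal_exp I 1 = I.
Proof. exact: ideal_mulT. Qed.

Lemma ideal_exp_pow I n a : I a -> ideal_exp I n (a ^+ n).
Proof.
move=> Ia; elim: n => [|n IH] //=; rewrite exprS; exact: mem_ideal_mul.
Qed.

Lemma ideal_expz_pow I (n : int) a : I a -> exists k, ideal_expz I n (a ^+ k).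
Proof.
by move=> Ia; case: n => [n|n]; [exists n; exact: ideal_exp_pow|exists 0%N].
Qed.

End IdealProduct.

Section QuotientIdeal.
Variables (R : comPzRingType) (J : set R).
Local Notation pi := (qring_pi J).

Lemma qring_pi_ideal (I : set R) : ideal I -> ideal (pi @` I).
Proof.
move=> iI; apply/submoduleP; split.
  exists 0; [exact: (submodule0 iI)|].
  by have := qring_piD J 0 0; rewrite addr0 -{1}[qring_pi J 0]addr0 => /addrI <-.
move=> a _ _ [u Iu <-] [v Iv <-]; exists ((repr a : R) * u + v).
  exact: (@submoduleL R R^o).
by rewrite qring_piD qring_pi_mul qring_piK.
Qed.

Lemma qring_pi_preimage (I : set (qring J)) : ideal I -> ideal (pi @^-1` I).
Proof.
move=> iI; apply/submoduleP; split.
  rewrite /=; have -> : pi 0 = 0.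
    by have := qring_piD J 0 0; rewrite addr0 -{1}[qring_pi J 0]addr0 => /addrI <-.
  exact: (submodule0 iI).
move=> a u v /= Iu Iv; rewrite qring_piD -[_ *: _]/(a * u) qring_pi_mul.
exact (@submoduleL _ (qring J)^o I (pi a) _ _ iI Iu Iv).
Qed.

Lemma qring_pi_mulset (I K : set R) :
  pi @` ideal_mul I K = ideal_mul (pi @` I) (pi @` K).
Proof.
apply/seteqP; split.
  suff : ideal_mul I K `<=` pi @^-1` ideal_mul (pi @` I) (pi @` K).
    by move=> h _ [a /h ? <-].
  apply: ideal_mul_min; first exact/qring_pi_preimage/ideal_mul_ideal.
  by move=> a b Ia Kb; rewrite /= qring_pi_mul; apply: mem_ideal_mul; [exists a|exists b].
apply: ideal_mul_min; first exact/qring_pi_ideal/ideal_mul_ideal.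
move=> _ _ [a Ia <-] [b Kb <-]; exists (a * b); first exact: mem_ideal_mul.
exact: qring_pi_mul.
Qed.

Lemma qring_pi_exp (I : set R) n : pi @` ideal_exp I n = ideal_exp (pi @` I) n.
Proof.
elim: n => [|n IH] /=; last by rewrite -IH -qring_pi_mulset.
apply/seteqP; split=> // u _; exists (repr u : R) => //; exact: qring_piK.
Qed.

End QuotientIdeal.

Section Superficial.
Variables (R : comPzRingType) (d : nat) (x : d.-tuple R) (I1 I2 : set R).
Hypothesis iI1 : ideal I1.

Lemma head_idealE (p : nat) : (p <= d)%N ->
  head_ideal (tnth x) p = ideal_gen [set` take p x].
Proof.
move=> pd; congr (ideal_gen _); apply/seteqP; split=> a.
  move=> [k kp <-]; rewrite /= (tnth_nth 0) -(nth_take 0 kp).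
  by rewrite mem_nth // size_takel // size_tuple.
move=> /= /(nthP 0)[k]; rewrite size_takel ?size_tuple // => kp.
rewrite nth_take // => <-; exists (Ordinal (leq_trans kp pd)) => //.
by rewrite (tnth_nth 0).
Qed.

Lemma head_idealT : head_ideal (tnth x) d = ideal_gen [set` x].
Proof. by rewrite head_idealE // take_oversize // size_tuple. Qed.

Lemma range_tnth : ideal_gen [set tnth x k | k in setT] = ideal_gen [set` x].
Proof.
rewrite -head_idealT; congr (ideal_gen _); apply/seteqP; split=> a [k _ <-].
  by exists k => //=.
by exists k.
Qed.

(** Superficiality with $s=1$, read in the quotient by the preceding elements, yields $l'\in
    I_1I_2^{n-1}$ such that $x_j(c-l')$ lies in their ideal; the regularity hypothesis cancels
    $x_j$. *)
Lemma superficial_colon (j : 'I_d) : superficial_seq I2 I1 x ->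
    (forall c, head_ideal (tnth x) j (tnth x j * c) -> head_ideal (tnth x) j c) ->
  exists r0 : nat, forall (n : int) c, r0%:Z <= n ->
    smod_add (ideal_mul I1 (ideal_expz I2 n) : set R^o)
      (head_ideal (tnth x) j : set R^o) (tnth x j * c) ->
    smod_add (ideal_mul I1 (ideal_expz I2 (n - 1)) : set R^o)
      (head_ideal (tnth x) j : set R^o) c.
Proof.
move=> [_ /(_ j)]; rewrite size_tuple => /(_ (ltn_ord j)) /=.
rewrite -(tnth_nth 0) -head_idealE; last exact: ltnW.
set J := head_ideal _ _ => -[_ [r0 [r0_gt0 sup]]] reg; exists r0 => -[r|//] c.
have iJ : ideal J by exact: ideal_gen_ideal.
rewrite lez_nat => rr0 [l Ll [b Jb lb]].
(* Positivity makes the truncated predecessor in [superficial] agree with $n-1$. *)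
have r_gt0 : (0 < r)%N by exact: leq_trans rr0.
have e1 : ideal_exp (qring_pi J @` I1) 1 = qring_pi J @` I1.
  exact/ideal_exp1/qring_pi_ideal.
have := sup r 1%N rr0; rewrite e1 -!qring_pi_exp -!qring_pi_mulset => /seteqP[+ _].
move=> /(_ (qring_pi J (tnth x j * c))) [].
  split; first by exists (qring_pi J c) => //; rewrite -qring_pi_mul.
  exists l => //; apply/qring_pi_eq => //.
  by rewrite -lb opprD addrA subrr sub0r; exact (@submoduleN R R^o J b iJ Jb).
move=> _ [l' Ll' <-]; rewrite -qring_pi_mul => /qring_pi_eq -/(_ iJ).
rewrite -mulrBr => /reg Jl; exists l'; last first.
  exists (c - l'); last by rewrite addrC subrK.
  by rewrite -opprB; exact (@submoduleN R R^o J _ iJ Jl).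
by rewrite subzn // subn1.
Qed.

Lemma reduction_pow (I J : set R) : ideal J -> reduction I J ->
  exists k, ideal_exp I k `<=` J.
Proof.
by move=> iJ [_ _ [k E]]; exists k.+1; rewrite -E; exact: ideal_mul_subl.
Qed.

End Superficial.

(** * The complexes C(1, n) *)

Section KoszulExt.
Variables (R : comPzRingType) (d : nat) (x : d.-tuple R).
Local Notation ext := {ffun {set 'I_d} -> R^o}.
Local Notation kdiff := (kdiff (tnth x) d).

(** Extension by zero from subsets of size $i$ to all subsets; with [ext_res] it carries results on
    the exterior algebra over to [koszul]. *)
Definition ext_of i (f : koszul R d i) : ext :=
  [ffun B : {set 'I_d} => oapp (fun A : ksub d i => f A : R^o) 0 (insub B)].

Definition ext_res i (f : ext) : koszul R d i := [ffun A => f (val A)].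

Lemma ext_ofE i (f : koszul R d i) A : ext_of f (val A) = f A.
Proof. by rewrite ffunE valK. Qed.

Lemma ext_of_out i (f : koszul R d i) (B : {set 'I_d}) : #|B| != i -> ext_of f B = 0.
Proof. by move=> Bi; rewrite ffunE insubN. Qed.

Lemma hom_ext_of i (f : koszul R d i) : hom_ext i d (ext_of f).
Proof.
apply/hom_extP => B fB; split=> //; apply/eqP.
by apply: contraNT fB => /ext_of_out->.
Qed.

Lemma ext_resK i (f : ext) : hom_ext i d f -> ext_of (ext_res i f) = f.
Proof.
move=> hf; apply/ffunP => B; rewrite ffunE.
case: insubP => [A _ <-|Bi] /=; first by rewrite ffunE.
by rewrite hf // (negPf Bi).
Qed.

Lemma ext_ofK i (f : koszul R d i) : ext_res i (ext_of f) = f.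
Proof. by apply/ffunP => A; rewrite ffunE ext_ofE. Qed.

Fact ext_of_linear i : linear (@ext_of i).
Proof.
move=> a f g; apply/ffunP => B; rewrite !ffunE.
by case: insub => [A|] /=; rewrite ?ffunE // scaler0 addr0.
Qed.
HB.instance Definition _ i := GRing.isLinear.Build _ _ _ _ _ (@ext_of_linear i).

Fact koszul_diff_linear i : linear (@koszul_diff R d x i).
Proof.
move=> a f g; apply/ffunP => B; rewrite !ffunE.
rewrite scaler_sumr -big_split; apply: eq_bigr => A _ /=.
rewrite scaler_sumr -big_split; apply: eq_bigr => j _ /=.
by rewrite !ffunE mulrDr -[RHS]/(a * _ + _) mulrCA.
Qed.
HB.instance Definition _ i := GRing.isLinear.Build _ _ _ _ _ (@koszul_diff_linear i).

(** For fixed $B$ and $j$, only $A=B\cup\{j\}$ contributes, and nothing does when $j\in B$. The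
    signs agree since $j$ is not below itself. *)
Lemma koszul_diff_res i (f : ext) :
  koszul_diff x (ext_res i.+1 f) = ext_res i (kdiff f).
Proof.
apply/ffunP => B; rewrite !ffunE /kdiff sum_ffunE.
rewrite (exchange_big_dep xpredT) //=.
rewrite [RHS](eq_bigl xpredT); last by move=> k; rewrite ltn_ord.
apply: eq_bigr => j _; rewrite !ffunE -[RHS]/(tnth x j * _).
have cB : #|val B| = i by apply/eqP; exact: (valP B).
case: ifPn => jB.
  rewrite mulr0 big_pred0 // => A; apply/negP => /andP[_ /eqP E].
  by move: jB; rewrite E setD11.
have cA : #|(j |: val B)%SET| == i.+1 by rewrite cardsU1 jB cB.
rewrite (big_pred1 (exist _ (j |: val B)%SET cA : ksub d i.+1)) => [|A].
  rewrite ffunE /= [RHS]mulrCA mulrA; congr (_ * _ * _); congr (_ ^+ #|pred_of_set _|).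
  apply/setP => l; rewrite !inE; case: eqP => // ->.
  by rewrite ltnn !andbF.
apply/andP/eqP => [[jA /eqP E]|->] /=.
  by apply/val_inj; rewrite /= E finset.setD1K.
by rewrite setU11 finset.setU1K.
Qed.

Lemma ext_of_diff i (f : koszul R d i.+1) : ext_of (koszul_diff x f) = kdiff (ext_of f).
Proof.
rewrite -{1}[f]ext_ofK koszul_diff_res ext_resK //.
exact (hom_kdiff _ (hom_ext_of f)).
Qed.

Lemma koszul_diff_diff i (f : koszul R d i.+2) : koszul_diff x (koszul_diff x f) = 0.
Proof.
rewrite -[LHS]ext_ofK !ext_of_diff kdiff_kdiff //.
by apply/ffunP => A; rewrite !ffunE.
Qed.

End KoszulExt.

(** * Homology lengths and Euler characteristic of $C(1,n)$ *)

Section Euler.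
Variables (R : comPzRingType) (d : nat) (x : d.-tuple R) (I1 I2 : set R).
Hypothesis xI2 : [set` x] `<=` I2.
Implicit Types (n : int) (i : nat).
Local Notation L n := (ideal_mul I1 (ideal_expz I2 n)).
Local Notation diff i := (@koszul_diff R d x i).
Local Notation proj n i := (@cplx_proj R d I1 I2 n i).

Lemma ideal_mul_expz n a j : L (n - 1) a -> L n (tnth x j * a).
Proof.
have := @cplx_idealM R I1 I2 n 0 (tnth x j) a (xI2 (mem_tnth _ _)).
by rewrite /cplx_ideal subr0.
Qed.

Fact cplx_proj_linear n i : linear (proj n i).
Proof.
by move=> a f g; apply/ffunP => A; rewrite !ffunE raddfD; congr (_ + _); exact: pi_scale.
Qed.
HB.instance Definition _ n i := GRing.isLinear.Build _ _ _ _ _ (@cplx_proj_linear n i).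

Definition kos_fil n i : set (koszul R d i) := [set f | forall A, L (n - i%:Z) (f A)].

Arguments kos_fil : clear implicits.

Lemma submodule_kos_fil n i : submodule (kos_fil n i).
Proof.
apply/submoduleP; split=> [A|a f g Lf Lg A]; rewrite !ffunE.
  exact: (submodule0 (ideal_mul_ideal _ _)).
exact (@submoduleL R R^o _ _ _ _ (ideal_mul_ideal _ _) (Lf A) (Lg A)).
Qed.

Lemma cplx_proj0 n i f : proj n i f = 0 <-> kos_fil n i f.
Proof.
have E A : proj n i f A = 0 <-> L (n - i%:Z) (f A).
  rewrite ffunE -[X in _ = X](raddf0 (\pi_(@qmod R R^o (cplx_ideal I1 I2 n i)))) /=.
  rewrite (rwP eqP) eq_pi_qmod subr0 inE (@span_id R R^o) //; exact: ideal_mul_ideal.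
split=> [h A|h]; first by apply/E; rewrite h ffunE.
by apply/ffunP => A; rewrite [RHS]ffunE; apply/E.
Qed.

Lemma cplx_proj_repr n i (u : cplx d I1 I2 n i) : exists f, proj n i f = u.
Proof.
by exists [ffun A => repr (u A)]; apply/ffunP => A; rewrite !ffunE reprK.
Qed.

(** Preimages in the free module of the boundaries and, with [kos_cy], of the cycles of $C(1,n)$.
    Both contain [kos_fil], the kernel of the projection. *)
Definition kos_bd n i : set (koszul R d i) := smod_add (range (diff i)) (kos_fil n i).
Definition kos_cy n i : set (koszul R d i) :=
  match i return set (koszul R d i) with
  | 0%N => setT
  | i'.+1 => diff i' @^-1` kos_fil n i'
  end.

Arguments kos_bd : clear implicits.
Arguments kos_cy : clear implicits.

Lemma submodule_kos_bd n i : submodule (kos_bd n i).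
Proof.
apply: submodule_add; last exact: submodule_kos_fil.
by apply: submodule_image; exact: submodule_setT.
Qed.

Lemma submodule_kos_cy n i : submodule (kos_cy n i).
Proof.
case: i => [|i]; first exact: submodule_setT.
by apply: submodule_preimage; exact: submodule_kos_fil.
Qed.

Lemma kos_fil_fil n i f : kos_fil n i f -> fil (fun k => L k) n (ext_of f).
Proof.
move=> Lf B; rewrite ffunE; case: insubP => [A _ <-|_] /=.
  rewrite [#|_|](eqP (valP A)); exact: Lf.
exact: (submodule0 (ideal_mul_ideal _ _)).
Qed.

Lemma fil_kos_fil n i F : fil (fun k => L k) n F -> kos_fil n i (ext_res i F).
Proof. by move=> LF A; rewrite ffunE; have := LF (val A); rewrite (eqP (valP A)). Qed.

Lemma kos_fil_diff n i f : kos_fil n i.+1 f -> kos_fil n i (diff i f).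
Proof.
move/kos_fil_fil => h; rewrite -[diff i f]ext_ofK ext_of_diff.
apply: fil_kos_fil; apply: fil_kdiff h => [k|k j a]; first exact: ideal_mul_ideal.
exact: ideal_mul_expz.
Qed.

Lemma kos_fil_bd n i : kos_fil n i `<=` kos_bd n i.
Proof.
by apply: smod_addr; apply: submodule_image; exact: submodule_setT.
Qed.

Lemma kos_bd_cy n i : kos_bd n i `<=` kos_cy n i.
Proof.
case: i => [|i] //; apply: smod_add_min.
- exact: submodule_kos_cy.
- move=> _ [g _ <-]; rewrite /= koszul_diff_diff.
  exact (submodule0 (submodule_kos_fil n i)).
- move=> f; exact: kos_fil_diff.
Qed.

Lemma cplx_proj_bd n i f : boundaries x (proj n i f) <-> kos_bd n i f.
Proof.
split.
  move=> [u _]; have [g <-] := cplx_proj_repr u.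
  rewrite cplx_diffE // => E; exists (diff i g); first by exists g.
  exists (f - diff i g); last by rewrite addrC subrK.
  by apply/cplx_proj0; rewrite linearB /= E subrr.
move=> [_ [g _ <-] [h Lh <-]]; exists (proj n i.+1 g) => //.
rewrite cplx_diffE // linearD /=; have -> : proj n i h = 0 by apply/cplx_proj0.
by rewrite addr0.
Qed.

Lemma cplx_proj_cy n i f : cycles x (proj n i f) <-> kos_cy n i f.
Proof.
case: i f => [|i] f //=; rewrite cplx_diffE //.
exact: cplx_proj0.
Qed.

Lemma submodule_boundaries n i : submodule (@boundaries R d I1 I2 x n i).
Proof.
have -> : @boundaries R d I1 I2 x n i = proj n i @` kos_bd n i.
  apply/seteqP; split=> u.
    by have [f <-] := cplx_proj_repr u => /cplx_proj_bd; exists f.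
  by move=> [f /cplx_proj_bd ? <-].
by apply: submodule_image; exact: submodule_kos_bd.
Qed.

Lemma hlenE n i : hlen I1 I2 x i n = len (kos_bd n i) (kos_cy n i).
Proof.
apply/esym/(len_iso (f := proj n i)).
- exact: submodule_kos_bd.
- exact: submodule_kos_cy.
- exact: submodule_boundaries.
- apply/seteqP; split=> u.
    have [f <-] := cplx_proj_repr u => /cplx_proj_cy cf.
    by apply: smod_addl; [exact: submodule_boundaries|exists f].
  move=> [_ [f cf <-] [v]]; have [g <-] := cplx_proj_repr v => /cplx_proj_bd bg <-.
  rewrite -[_ + _](linearD (proj n i)); apply/cplx_proj_cy.
  apply (submoduleD (submodule_kos_cy n i) cf); exact: kos_bd_cy.
- apply/seteqP; split=> f; last by move=> [_ /cplx_proj_bd].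
  by move=> bf; split; [exact: kos_bd_cy|apply/cplx_proj_bd].
Qed.

Hypothesis finL : forall n, flen (L n : set R^o) setT.

Lemma has_len_kos_fil n i :
  has_len (kos_fil n i) setT ('C(d, i) * hilb I1 I2 (n - i%:Z)).
Proof.
have := has_len_ffun (ksub d i) (ideal_mul_ideal _ _) (flenP (finL (n - i%:Z))).
by rewrite card_sig -[X in (X * _)%N]cardsE card_draws card_ord.
Qed.

(** First isomorphism theorem for the differential of $C(1,n)$, read in the free modules. *)
Lemma len_kos_cy n i : len (kos_cy n i.+1) setT = len (kos_fil n i) (kos_bd n i).
Proof.
apply: (len_iso (f := diff i)).
- exact: submodule_kos_cy.
- exact: submodule_setT.
- exact: submodule_kos_fil.
- by [].
- by rewrite setTI.
Qed.

Lemma kos_rank n i : ('C(d, i) * hilb I1 I2 (n - i%:Z) =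
  len (kos_fil n i) (kos_bd n i) + hlen I1 I2 x i n + len (kos_cy n i) setT)%N.
Proof.
have h := has_len_kos_fil n i; rewrite -(has_lenE h).
have sb := submodule_kos_bd n i; have sc := submodule_kos_cy n i.
have fl : flen (kos_fil n i) setT by eexists; exact: h.
have [fl1 fl2] := flen_sub sb (@kos_fil_bd n i) (@subsetT _ _) fl.
rewrite (len_add sb (@kos_fil_bd n i) (@subsetT _ _) fl) hlenE.
by rewrite (len_add sc (@kos_bd_cy n i) (@subsetT _ _) fl2) addnA.
Qed.

Lemma kos_bd_top n : len (kos_fil n d) (kos_bd n d) = 0%N.
Proof.
suff -> : kos_bd n d = kos_fil n d by apply/len_xx/submodule_kos_fil.
apply/seteqP; split; last exact: kos_fil_bd.
apply: smod_add_min => //; first exact: submodule_kos_fil.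
move=> _ [g _ <-]; have -> : g = 0.
  apply/ffunP => A; have : (#|val A| <= d)%N by rewrite -[leqRHS]card_ord max_card.
  by rewrite (eqP (valP A)) ltnn.
rewrite linear0; exact (submodule0 (submodule_kos_fil n d)).
Qed.

(** The alternating sum cut at degree $k$ telescopes, leaving only the length of the boundaries in
    degree $k$, which vanishes for $k=d$. *)
Lemma euler_char n : \sum_(0 <= i < d.+1) (-1) ^+ i * (hlen I1 I2 x i n)%:R =
  \sum_(0 <= i < d.+1) (-1) ^+ i * ('C(d, i) * hilb I1 I2 (n - i%:Z))%:R :> rat.
Proof.
have H k : \sum_(0 <= i < k.+1) (-1) ^+ i * ('C(d, i) * hilb I1 I2 (n - i%:Z))%:R =
    \sum_(0 <= i < k.+1) (-1) ^+ i * (hlen I1 I2 x i n)%:R +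
    (-1) ^+ k * (len (kos_fil n k) (kos_bd n k))%:R :> rat.
  elim: k => [|k IH].
    have z0 : len (kos_cy n 0) setT = 0%N by apply: len_xx; exact: submodule_setT.
    by rewrite !big_nat1 kos_rank z0 !natrD !expr0 !mul1r addr0 addrC.
  rewrite big_nat_recr //= IH [in RHS]big_nat_recr //= kos_rank len_kos_cy !natrD !mulrDr.
  by rewrite exprS; ring.
by rewrite H kos_bd_top mulr0 addr0.
Qed.

Lemma iter_bdiff (f : int -> rat) k n : iter k bdiff f n =
  \sum_(0 <= i < k.+1) (-1) ^+ i * 'C(k, i)%:R * f (n - i%:Z).
Proof.
elim: k n => [|k IH] n; first by rewrite big_nat1 expr0 bin0 !mul1r subr0.
rewrite /= /bdiff !IH [RHS]big_nat_recl // bin0 expr0 !mul1r subr0.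
rewrite [X in X - _]big_nat_recl // bin0 expr0 !mul1r subr0 -addrA; congr (_ + _).
under [in RHS]eq_bigr do rewrite binS natrD mulrDr mulrDl.
rewrite big_split /=; congr (_ + _).
  by rewrite [RHS]big_nat_recr //= bin_small // mulr0 mul0r addr0.
rewrite -sumrN; apply: eq_bigr => i _.
by rewrite exprS mulN1r !mulNr -addrA -opprD -PoszD add1n.
Qed.

Lemma euler_hilb n : \sum_(0 <= i < d.+1) (-1) ^+ i * (hlen I1 I2 x i n)%:R =
  iter d bdiff (fun k => (hilb I1 I2 k)%:R) n.
Proof.
rewrite euler_char iter_bdiff; apply: eq_bigr => i _.
by rewrite natrM mulrA.
Qed.

Lemma hlen_eq0 n i : fil_exact (tnth x) (fun k => L k) d n -> hlen I1 I2 x i.+1 n = 0%N.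
Proof.
move=> ex; rewrite hlenE.
suff -> : kos_cy n i.+1 = kos_bd n i.+1 by apply/len_xx/submodule_kos_bd.
apply/seteqP; split; last exact: kos_bd_cy.
move=> f /= /kos_fil_fil; rewrite ext_of_diff => /(ex _ _ (hom_ext_of f))[g hg].
move/(@fil_kos_fil n i.+1) => h.
exists (diff i.+1 (ext_res i.+2 g)); first by exists (ext_res i.+2 g).
exists (f - diff i.+1 (ext_res i.+2 g)); last by rewrite addrC subrK.
rewrite koszul_diff_res; move: h; congr (kos_fil _ _ _).
by rewrite -{2}[f]ext_ofK; apply/ffunP => A; rewrite !ffunE.
Qed.

End Euler.
Arguments kos_fil {R d} I1 I2 n i _.
Arguments submodule_kos_fil {R d} I1 I2 n i.
Arguments kos_fil_fil {R d I1 I2 n i f} _ B.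

(** * Polynomials and iterated backward differences *)

Lemma poly_eq_const (Q : {poly rat}) (n0 : int) (c : rat) :
  (forall n : int, n0 <= n -> Q.[n%:~R] = c) -> forall a, Q.[a] = c.
Proof.
move=> Qc a; suff /eqP -> : Q == c%:P by rewrite hornerC.
rewrite -subr_eq0; apply/eqP; apply: contraTeq isT => Q0.
pose s := [seq (n0 + i%:Z)%:~R : rat | i <- iota 0 (size (Q - c%:P))].
have := max_poly_roots (rs := s) Q0.
rewrite size_map size_iota ltnn; apply.
  apply/allP => _ /mapP[i _ ->]; rewrite /root hornerD hornerN hornerC Qc ?subrr //.
  by rewrite lerDl.
by rewrite map_inj_uniq ?iota_uniq // => i j /intr_inj /addrI [].
Qed.

(** The iterated difference is itself given by a polynomial, a combination of shifts of [P]; being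
    constant at all large integers, that polynomial is constant. *)
Lemma bdiff_poly_const (P : {poly rat}) d (n0 : int) (c : rat) :
    (forall n : int, n0 <= n -> iter d bdiff (fun k => P.[k%:~R]) n = c) ->
  forall n : int, iter d bdiff (fun k => P.[k%:~R]) n = c.
Proof.
pose Q : {poly rat} := \sum_(0 <= i < d.+1)
  ((-1) ^+ i * 'C(d, i)%:R) *: (P \Po ('X - (i%:R)%:P)).
have QE (n : int) : iter d bdiff (fun k => P.[k%:~R]) n = Q.[n%:~R].
  rewrite iter_bdiff horner_sum; apply: eq_bigr => i _.
  by rewrite hornerZ horner_comp hornerXsubC intrB.
move=> h n; rewrite QE; apply: (poly_eq_const (n0 := n0)) => k nk.
by rewrite -QE h.
Qed.

Lemma iter_bdiffB (f g : int -> rat) d n :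
  iter d bdiff (fun k => f k - g k) n = iter d bdiff f n - iter d bdiff g n.
Proof.
rewrite !iter_bdiff -sumrB; apply: eq_bigr => i _; exact: mulrBr.
Qed.

Lemma eq_iter_bdiff (f g : int -> rat) d n :
  (forall k, n - d%:Z <= k -> f k = g k) -> iter d bdiff f n = iter d bdiff g n.
Proof.
move=> fg; rewrite !iter_bdiff; apply: eq_big_nat => i /andP[_ id].
by rewrite fg // lerD2l lerN2 lez_nat.
Qed.

(** * Homology of $C(1,n)$ in degrees zero and one *)

Section LowHomology.
Variables (R : comPzRingType) (d : nat) (x : d.-tuple R) (I1 I2 : set R).
Hypothesis xI2 : [set` x] `<=` I2.
Local Notation L n := (ideal_mul I1 (ideal_expz I2 n)).
Local Notation X := (ideal_gen [set` x]).
Implicit Types n : int.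

(** Degree zero chains have a single coordinate, at the empty set; this identifies them with $R$. *)
Definition kos0_val (f : koszul R d 0) : R^o := ext_of f finset.set0.

Fact kos0_val_linear : linear kos0_val.
Proof. by move=> a f g; rewrite /kos0_val linearP !ffunE. Qed.
HB.instance Definition _ := GRing.isLinear.Build _ _ _ _ _ kos0_val_linear.

Definition kos0_const (c : R) : koszul R d 0 := ext_res 0 (ext_const d c).

Lemma kos0_constK c : kos0_val (kos0_const c) = c.
Proof. by rewrite /kos0_val ext_resK ?ffunE ?eqxx //; exact: hom_const. Qed.

Lemma kos0_fil n f : kos_fil I1 I2 n 0 f <-> L n (kos0_val f).
Proof.
split=> [Lf|Lf A].
  have := kos_fil_fil Lf finset.set0.
  by rewrite cards0 subr0.
have A0 : val A = finset.set0 by apply/eqP; rewrite -cards_eq0; exact: (valP A).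
by rewrite subr0 -ext_ofE A0.
Qed.

Lemma kos0_val_diff f : kos0_val (koszul_diff x f) = \sum_k tnth x k * ext_of f [set k]%SET.
Proof.
rewrite /kos0_val ext_of_diff /kdiff sum_ffunE.
rewrite (eq_bigl xpredT); last by move=> k; rewrite ltn_ord.
apply: eq_bigr => k _; rewrite !ffunE inE finset.setU0 -[LHS]/(_ * _); congr (_ * _).
have -> : ksign R k finset.set0 = 1; last by rewrite mul1r.
by rewrite /ksign (_ : [set _ in _ | _]%SET = finset.set0) ?cards0 //;
  apply/setP => l; rewrite !inE.
Qed.

Lemma kos0_val_diff_range c : X c <-> exists f, kos0_val (koszul_diff x f) = c.
Proof.
rewrite -head_idealT head_idealP //; split=> [[u hu uc]|[f fc]].
  exists (ext_res 1 u); rewrite /kos0_val ext_of_diff ext_resK // uc.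
  by rewrite ffunE eqxx.
exists (ext_of f); first exact (hom_ext_of f).
rewrite -fc -ext_of_diff; apply: (@hom0_const _ _ d); exact (hom_ext_of _).
Qed.

Lemma kos0_val_fil n c : ideal_mul X (L (n - 1)) c <->
  exists2 f, kos_fil I1 I2 n 1 f & kos0_val (koszul_diff x f) = c.
Proof.
have iL k : ideal (L k) by exact: ideal_mul_ideal.
split=> [|[f Lf <-]]; last first.
  rewrite kos0_val_diff; apply: (@submodule_sum R R^o) => [|k _].
    exact: ideal_mul_ideal.
  apply: mem_ideal_mul; first by apply: sub_ideal_gen; exact: mem_tnth.
  by have := kos_fil_fil Lf [set k]%SET; rewrite cards1.
have sF := submodule_kos_fil (d := d) I1 I2 n 1.
have sY : ideal [set c | exists2 f, kos_fil I1 I2 n 1 f &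
    kos0_val (koszul_diff x f) = c].
  apply/submoduleP; split.
    by exists 0; [exact (submodule0 sF)|rewrite !linear0].
  move=> a _ _ [f Lf <-] [g Lg <-]; exists (a *: f + g); first exact (submoduleL a sF Lf Lg).
  by rewrite !linearP.
apply: (ideal_mul_min sY) => a b /kos0_val_diff_range[f fa] Lb.
exists (b *: f); last by rewrite !linearZ /= fa mulrC.
by move=> A; rewrite ffunE -[_ *: _]/(_ * _) mulrC; exact (idealM _ (iL _) Lb).
Qed.

Lemma hlen0E n : hlen I1 I2 x 0 n = len (smod_add (L n : set R^o) (X : set R^o)) setT.
Proof.
have iL : ideal (L n) by exact: ideal_mul_ideal.
have iX : ideal X by exact: ideal_gen_ideal.
rewrite hlenE //; apply: (len_iso (f := kos0_val)).
- exact: submodule_kos_bd.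
- exact: submodule_setT.
- exact: submodule_add.
- apply/seteqP; split=> // c _; apply: smod_addl; first exact: submodule_add.
  by exists (kos0_const c) => //; exact: kos0_constK.
- rewrite setTI; apply/seteqP; split=> f.
    move=> [_ [g _ <-] [h Lh <-]]; rewrite /= linearD addrC.
    exists (kos0_val h); first exact/kos0_fil.
    by exists (kos0_val (koszul_diff x g)) => //; apply/kos0_val_diff_range; exists g.
  move=> [l Ll [c /kos0_val_diff_range[g gc] lc]].
  exists (koszul_diff x g); first by exists g.
  exists (f - koszul_diff x g); last by rewrite addrC subrK.
  by apply/kos0_fil; rewrite linearB /= gc -lc addrK.
Qed.

Lemma ideal_mul_gen_sub n : ideal_mul X (L (n - 1)) `<=` X `&` L n.
Proof.
move=> c /kos0_val_fil[f Lf <-]; split; first by apply/kos0_val_diff_range; exists f.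
by apply/kos0_fil; exact: kos_fil_diff.
Qed.

(** The map $f\mapsto\sum_k x_kf_k$ sends the cycles onto $X\cap L(n)$ and the filtered chains onto
    $XL(n-1)$; its kernel consists of Koszul cycles over $R$, which are boundaries. *)
Lemma hlen1E n : koszul_acyclic (tnth x) d ->
  hlen I1 I2 x 1 n = len (ideal_mul X (L (n - 1)) : set R^o) (X `&` L n).
Proof.
move=> ac; have iL k : ideal (L k) by exact: ideal_mul_ideal.
have iX : ideal X by exact: ideal_gen_ideal.
have iXL : ideal (ideal_mul X (L (n - 1))) by exact: ideal_mul_ideal.
pose ev : {linear koszul R d 1 -> R^o} := kos0_val \o @koszul_diff R d x 0.
rewrite hlenE //; apply: (len_iso (f := ev)).
- exact: submodule_kos_bd.
- exact: submodule_kos_cy.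
- exact: iXL.
- apply/seteqP; split=> c.
    move=> [/kos0_val_diff_range[f fc] Lc]; apply: smod_addl => //.
    by exists f => //; apply/kos0_fil; rewrite fc.
  apply: smod_add_min; [exact (submodule_setI iX (iL n))| |exact: ideal_mul_gen_sub].
  move=> _ [f /kos0_fil Lf <-]; split=> //.
  by apply/kos0_val_diff_range; exists f.
- apply/seteqP; split=> f.
    move=> bf; split; first exact: kos_bd_cy.
    case: bf => _ [g _ <-] [h Lh <-]; rewrite /= linearD /= koszul_diff_diff add0r.
    by apply/kos0_val_fil; exists h.
  (* Subtracting the filtered chain $h$ with the same image turns $f$ into a cycle over $R$, to
     which acyclicity applies. *)
  move=> [_ /kos0_val_fil[h Lh e]].
  have k0 : koszul_diff x (f - h) = 0.
    apply/ffunP => A; rewrite -ext_ofE [RHS]ffunE.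
    have -> : val A = finset.set0 by apply/eqP; rewrite -cards_eq0; exact: (valP A).
    by rewrite -/(kos0_val _) !linearB /= e subrr.
  have [|g hg gE] := ac 0%N _ (hom_ext_of (f - h)).
    by rewrite -ext_of_diff k0 linear0.
  exists (koszul_diff x (ext_res 2 g)); first by exists (ext_res 2 g).
  exists h => //; rewrite koszul_diff_res -gE ext_ofK; exact: subrK.
Qed.

End LowHomology.

(** * The difference formula for the Hilbert function and its polynomial *)

Theorem lemma5p3 (R : comNzRingType) (m : set R) (d : nat)
    (I1 I2 : set R) (x : d.-tuple R) (P : {poly rat}) (n : int)
    (hR : cohen_macaulay_local m) (hdim : krull_dim R d) (hd : (2 <= d)%N)
    (hres : infinite_set [set: qring m])
    (hI1 : primary_to m I1) (hI2 : primary_to m I2)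
    (hred : minimal_reduction I2 (ideal_gen [set` x]))
    (hsup : superficial_seq I2 I1 x)
    (hP : hilb_poly I1 I2 P) (hn : 1 <= n) :
  let X : set R := ideal_gen [set` x] in
  iter d bdiff (fun k : int => P.[k%:~R] - (hilb I1 I2 k)%:R) n =
    (ideal_len X (ideal_add (ideal_mul I1 (ideal_expz I2 n)) X))%:R
      - \sum_(1 <= i < d.+1) (-1) ^+ i * (hlen I1 I2 x i n)%:R
  /\
  (ideal_len X (ideal_add (ideal_mul I1 (ideal_expz I2 n)) X))%:R
      - \sum_(1 <= i < d.+1) (-1) ^+ i * (hlen I1 I2 x i n)%:R =
    (ideal_len (ideal_mul X (ideal_mul I1 (ideal_expz I2 (n - 1))))
               (ideal_mul I1 (ideal_expz I2 n)))%:R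
      - \sum_(2 <= i < d.+1) (-1) ^+ i * (hlen I1 I2 x i n)%:R :> rat.
Proof.
move=> X.
have xI2 : [set` x] `<=` I2 := hsup.1.
have [locR [d' [kd' dep]]] := hR.
have [[s [regs sm] sd] _] : depth m d by rewrite (is_max_uniq hdim kd').
have [[iI1 _ _] rI1] := hI1; have [[iI2 _ _] rI2] := hI2.
have iX : ideal X by exact: ideal_gen_ideal.
pose L (k : int) : set R := ideal_mul I1 (ideal_expz I2 k).
have iL k : ideal (L k) by exact: ideal_mul_ideal.
have mx j : m (tnth x j).
  by rewrite -rI2; exists 1%N; rewrite expr1; apply: xI2; exact: mem_tnth.
(* Some $a^q$ lies in $I_2$, and the reduction gives $I_2^k\subseteq X$ for some $k$. *)
have nilX a : m a -> exists k, X (a ^+ k).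
  rewrite -{1}rI2 => -[q aq]; have [k Xk] := reduction_pow iX hred.1.
  by exists (q * k)%N; apply: Xk; rewrite exprM; exact: ideal_exp_pow.
have nilL k a : m a -> exists l, L k (a ^+ l).
  move=> ma; have [p ap] : exists p, I1 (a ^+ p) by move: ma; rewrite -rI1 => -[q aq]; exists q.
  have [q aq] : exists q, I2 (a ^+ q) by move: ma; rewrite -rI2 => -[q aq]; exists q.
  have [l al] := ideal_expz_pow k aq.
  by exists (p + q * l)%N; rewrite exprD exprM; exact: mem_ideal_mul.
have nilXL k a : m a -> exists l, ideal_mul X (L k) (a ^+ l).
  move=> ma; have [p ap] := nilX a ma; have [q aq] := nilL k a ma.
  by exists (p + q)%N; rewrite exprD; exact: mem_ideal_mul.
have finL k : flen (L k : set R^o) setT by apply: (flen_colength locR) => // a; exact: nilL.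
have ac : koszul_acyclic (tnth x) d.
  by apply: (regular_koszul_acyclic regs sd sm) => y; rewrite range_tnth; exact: nilX.
have [n0 ex] : exists n0 : int, forall k, n0 <= k -> fil_exact (tnth x) L d k.
  have colon j := superficial_colon iI1 hsup (fun c =>
    acyclic_regular (koszul_acyclic_all locR mx ac (ltn_ord j))).
  have [r hr] := choice colon.
  (* The maximum serves all colon conditions at once; $d$ is the loss over the $d$ cone steps. *)
  exists ((\max_j r j)%N%:Z + d%:Z).
  apply: fil_exact_large => // [k j a|j k c rk]; first exact: ideal_mul_expz.
  by apply: hr; apply: le_trans rk; rewrite lez_nat; exact: leq_bigmax.
have [r Xr] := reduction_pow iX hred.1.
have XL k : r%:Z <= k -> smod_add (L k : set R^o) (X : set R^o) = X.
  move=> rk; apply/seteqP; split; last exact (@smod_addr R R^o _ _ (iL k)).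
  apply: smod_add_min => //; case: k rk => // k rk a La; apply: Xr.
  by apply: (ideal_exp_anti rk); apply: ideal_mul_subr La; exact: ideal_exp_ideal.
have Hlarge k : n0 <= k -> r%:Z <= k ->
    iter d bdiff (fun k => (hilb I1 I2 k)%:R) k = (ideal_len X setT)%:R :> rat.
  move=> k0 kr; rewrite -(euler_hilb xI2 finL) big_nat_recl // big1 => [|i _].
    by rewrite expr0 mul1r addr0 hlen0E // XL.
  by rewrite hlen_eq0 ?mulr0 //; exact: ex.
have [n1 hP1] := hP.
have HP : iter d bdiff (fun k : int => P.[k%:~R]) n = (ideal_len X setT)%:R.
  (* The summand $d$ in [n1 + d] keeps every shift $k-i$ with $i\le d$ in the range where $P$ and
     $H$ agree. *)
  apply: (bdiff_poly_const (n0 := Order.max (Order.max n0 r%:Z) (n1 + d%:Z))) => k.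
  rewrite !ge_max => /andP[/andP[k0 kr] k1]; rewrite -(Hlarge k k0 kr).
  apply: eq_iter_bdiff => l kl; apply: hP1; apply: le_trans kl.
  by rewrite lerBrDr.
have finX : flen (X : set R^o) setT by apply: (flen_colength locR).
pose Y : set R^o := smod_add (L n : set R^o) (X : set R^o).
have sY : submodule Y := submodule_add (iL n) iX.
have XY : X `<=` Y by exact (@smod_addr R R^o _ _ (iL n)).
have lX : ideal_len X setT = (ideal_len X Y + hlen I1 I2 x 0 n)%N.
  rewrite hlen0E //; exact (len_add sY XY (@subsetT _ _) finX).
(* Second isomorphism theorem, $(L(n)+X)/X\cong L(n)/(X\cap L(n))$, induced by the identity map. *)
have lY : ideal_len X Y = len (X `&` L n : set R^o) (L n).
  have e : Y = smod_add (idfun @` (L n : set R^o)) (X : set R^o) by rewrite image_id.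
  exact (esym (len_iso (submodule_setI iX (iL n)) (iL n) iX e (setIC _ _))).
have sXL : X `&` L n `<=` L n by move=> a [].
have XLs := ideal_mul_gen_sub xI2 (I1 := I1) (n := n).
(* Additivity along $XL(n-1)\subseteq X\cap L(n)\subseteq L(n)$: absorbing $h_1$ into the leading
   term passes from the first formula to the second. *)
have lXL : ideal_len (ideal_mul X (L (n - 1))) (L n) =
    (hlen I1 I2 x 1 n + ideal_len X Y)%N.
  rewrite lY hlen1E //; apply: len_add => //.
    exact (submodule_setI iX (iL n)).
  have fl : flen (ideal_mul X (L (n - 1)) : set R^o) setT.
    by apply: (flen_colength locR) => [|a]; [exact: ideal_mul_ideal|exact: nilXL].
  by have [] := flen_sub (iL n) (subset_trans XLs sXL) (@subsetT _ _) fl.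
have eul := euler_hilb xI2 finL n; rewrite big_nat_recl // expr0 mul1r in eul.
split.
  rewrite iter_bdiffB HP -eul lX natrD [RHS]/=.
  rewrite -[ideal_add _ _]/Y big_add1 /=; ring.
rewrite -/(L n) -/(L (n - 1)) lXL [in LHS]big_ltn ?ltnS 1?ltnW // expr1 natrD.
rewrite -[ideal_add _ _]/Y; ring.
Qed.
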